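(* Let $\mathbb{G}$ be a Green kernel of type $(s,\gamma)$ on $\Omega$ with Green operator $\mathcal{G}$, admitting a $\gamma$-normal derivative $D_\gamma\mathbb{G}$. Let $h\in C(\partial\Omega)$ and assume $\gamma>s-\frac12$. Then the unique $u\in L^1_{loc}(\Omega)$ satisfying $$\int_\Omega u\,\psi=\int_{\partial\Omega}h(z)\,D_\gamma[\mathcal{G}(\psi)](z)\,dz\qquad\text{for any }\psi\in L^\infty_c(\Omega)$$ satisfies $$\lim_{x\to\theta,\ x\in\Omega}\frac{u(x)}{u^\star(x)}=h(\theta)\qquad\text{uniformly in }\theta\in\partial\Omega,$$ where $u^\star(x)=\int_{\partial\Omega}D_\gamma\mathbb{G}(z,x)\,dz$.
   Context: $\Omega\subset\mathbb{R}^n$ ($n\ge1$) is a bounded domain with $C^{1,1}$ boundary and $\delta(x)=\mathrm{dist}(x,\partial\Omega)$. Write $a\wedge b=\min\{a,b\}$. For nonnegative functions, $f\asymp g$ on a set means that there is a constant $C>0$ with $C^{-1}g\le f\le Cg$ on that set. $L^\infty_c(\Omega)$ is the space of bounded measurable functions with compact support in $\Omega$. $dz$ on $\partial\Omega$ is surface measure (counting measure if $n=1$). A Green kernel of type $(s,\gamma)$ on $\Omega$, where $s,\gamma\in(0,1]$ and $2s\le n$, is a measurable function $\mathbb{G}:\Omega\times\Omega\to\mathbb{R}$ such that $\mathbb{G}(x,y)=\mathbb{G}(y,x)$ and $$\mathbb{G}(x,y)\asymp\frac{1}{|x-y|^{n-2s}}\Big(\frac{\delta(x)\delta(y)}{|x-y|^2}\wedge1\Big)^\gamma,\qquad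 x,y\in\Omega,\ x\ne y.$$ Its Green operator is $\mathcal{G}(f)(x)=\int_\Omega\mathbb{G}(x,y)f(y)\,dy$. $\mathbb{G}$ admits a $\gamma$-normal derivative if there exists a (measurable) function $D_\gamma\mathbb{G}:\partial\Omega\times\Omega\to\mathbb{R}$ such that for every $z\in\partial\Omega$ and every sequence $x_j\in\Omega$ with $x_j\to z$ one has $\lim_j\mathbb{G}(x_j,\cdot)/\delta(x_j)^\gamma=D_\gamma\mathbb{G}(z,\cdot)$ a.e. in $\Omega$. For a function $u$ on $\Omega$, $D_\gamma u(z)=\lim_{x\to z,\,x\in\Omega}u(x)/\delta(x)^\gamma$ for $z\in\partial\Omega$; this limit exists when $u=\mathcal{G}(\psi)$ with $\psi\in L^\infty_c(\Omega)$. The unique solution $u$ of the displayed problem is represented by $u(x)=\int_{\partial\Omega}D_\gamma\mathbb{G}(z,x)h(z)\,dz$. Since $u$ and $u^\star$ are elements of $L^1_{loc}(\Omega)$, pointwise statements about them are understood up to null sets of $x\in\Omega$. *)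

(* Defs.v *)
From HB Require Import structures.
From mathcomp Require Import all_boot all_order all_algebra.
From mathcomp Require Import all_classical all_reals all_analysis.

Set Implicit Arguments.
Unset Strict Implicit.
Unset Printing Implicit Defensive.

Import Order.TTheory GRing.Theory Num.Theory.
Import numFieldNormedType.Exports.

Local Open Scope classical_set_scope.
Local Open Scope ring_scope.

(* The library's norm on 'rV[R]_n is the sup norm; it induces the same topology
   as the Euclidean norm, but metric quantities need the latter. *)
Definition enorm (R : realType) n (x : 'rV[R]_n) : R :=
  Num.sqrt (\sum_(i < n) x 0 i ^+ 2).

Definition boundary (T : topologicalType) (A : set T) : set T :=
  closure A `\` A°.

Definition bdist (R : realType) n (Omega : set 'rV[R]_n) (x : 'rV[R]_n) : R :=
  inf [set enorm (x - z) | z in boundary Omega].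

Section cover_outer_measure.
Context (R : realType) (T : pointedType).
Implicit Types (w : set T -> \bar R) (A : set T).
Local Open Scope ereal_scope.

Definition cover_outer w A : \bar R :=
  ereal_inf [set \sum_(k <oo) w (F k) |
             F in [set F : (set T)^nat | A `<=` \bigcup_k F k]].

Let D := g_sigma_algebraType [set: set T].

Lemma cover_outerE w : cover_outer w = mu_ext (w : set D -> \bar R).
Proof.
apply/funext => A; congr (ereal_inf (image _ _)).
apply/seteqP; split => F /=; last by case.
by move=> AF; split => // i; apply: sub_sigma_algebra.
Qed.

Variable w : set T -> \bar R.
Hypotheses (w0 : w set0 = 0) (w_ge0 : forall A, 0 <= w A).

Lemma cover_outer0 : cover_outer w set0 = 0.
Proof. by rewrite cover_outerE; exact: (@mu_ext0 _ D). Qed.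

Lemma cover_outer_ge0 A : 0 <= cover_outer w A.
Proof. by rewrite cover_outerE; exact: (@mu_ext_ge0 _ D). Qed.

Lemma le_cover_outer : {homo cover_outer w : A B / A `<=` B >-> A <= B}.
Proof. by rewrite cover_outerE; exact: (@le_mu_ext _ D). Qed.

Lemma cover_outer_sigma_subadditive : sigma_subadditive (cover_outer w).
Proof. by rewrite cover_outerE; exact: (@mu_ext_sigma_subadditive _ D). Qed.

End cover_outer_measure.

Section lebesgue_Rn.
Context (R : realType) (n : nat).
Implicit Types (a b x : 'rV[R]_n.+1) (A : set 'rV[R]_n.+1).
Local Open Scope ereal_scope.

Definition box a b : set 'rV[R]_n.+1 :=
  [set x | forall i, (a 0 i <= x 0 i <= b 0 i)%R].

(* The least volume of a box containing A, hence the volume of A if A is a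
   closed box, and +oo if A is unbounded. *)
Definition box_vol A : \bar R :=
  ereal_inf [set ((\prod_(i < n.+1) (ab.2 0 i - ab.1 0 i))%R)%:E |
             ab in [set ab : 'rV[R]_n.+1 * 'rV[R]_n.+1 |
                    (forall i, (ab.1 0 i <= ab.2 0 i)%R) /\
                    A `<=` box ab.1 ab.2]].

Lemma box_vol_ge0 A : 0 <= box_vol A.
Proof.
apply: le_ereal_inf_tmp => _ [[a b] /= [ab _] <-].
by rewrite lee_fin; apply: prodr_ge0 => i _; rewrite subr_ge0.
Qed.

Lemma box_vol0 : box_vol set0 = 0.
Proof.
apply/eqP; rewrite eq_le box_vol_ge0 andbT; apply: ereal_inf_lbound.
exists (0%R, 0%R) => /=; first by split.
by rewrite big_ord_recl mxE subrr mul0r.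
Qed.

Definition lebesgue_outer : set 'rV[R]_n.+1 -> \bar R := cover_outer box_vol.

HB.instance Definition _ := isOuterMeasure.Build R 'rV[R]_n.+1 lebesgue_outer
  (cover_outer0 box_vol0 box_vol_ge0) (cover_outer_ge0 box_vol_ge0)
  (@le_cover_outer _ _ box_vol)
  (cover_outer_sigma_subadditive box_vol_ge0).

(* Lebesgue measure, on the complete sigma-algebra of Lebesgue measurable sets. *)
Definition lebesgue_Rn :
    {measure set (caratheodory_type lebesgue_outer) -> \bar R} :=
  let mu : {outer_measure set 'rV[R]_n.+1 -> \bar R} := lebesgue_outer in
  mu : set (caratheodory_type mu) -> \bar R.

End lebesgue_Rn.

(* Volume of the unit ball of R^k. *)
Fixpoint ball_vol (R : realType) (k : nat) : R :=
  match k with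
  | 0 => 1
  | 1 => 2
  | (k'.+2)%N => 2 * pi / k%:R * ball_vol R k'
  end.

Section hausdorff.
Context (R : realType) (n : nat).
Implicit Types A : set 'rV[R]_n.+1.
Local Open Scope ereal_scope.

Definition diam A : \bar R :=
  ereal_sup [set (enorm (xy.1 - xy.2))%:E |
             xy in [set xy : 'rV[R]_n.+1 * 'rV[R]_n.+1 | A xy.1 /\ A xy.2]].

(* Dimension n in R^(n+1), with the normalization that gives the n-dimensional
   area. A singleton has weight 1 if n = 0, because 0 ^+ 0 = 1. *)
Definition hausdorff_weight (d : R) A : \bar R :=
  if `[< A = set0 >] then 0
  else if diam A <= d%:E then
    (ball_vol R n * (fine (diam A) / 2) ^+ n)%R%:E
  else +oo.

Definition hausdorff_outer A : \bar R :=
  ereal_sup [set cover_outer (hausdorff_weight d) A | d in [set d : R | (0 < d)%R]].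

Lemma ball_vol_ge0 k : (0 <= ball_vol R k)%R.
Proof.
suff : (0 <= ball_vol R k)%R /\ (0 <= ball_vol R k.+1)%R by case.
elim: k => [//|k [k0 k1]]; split => //.
by rewrite /= mulr_ge0// divr_ge0// mulr_ge0// pi_ge0.
Qed.

Lemma hausdorff_weight0 d : hausdorff_weight d set0 = 0.
Proof. by rewrite /hausdorff_weight asboolT. Qed.

Lemma hausdorff_weight_ge0 d A : 0 <= hausdorff_weight d A.
Proof.
rewrite /hausdorff_weight; case: asboolP => // /eqP/set0P[x Ax].
case: ifPn => // _; rewrite lee_fin mulr_ge0 ?ball_vol_ge0// exprn_ge0//.
rewrite divr_ge0// fine_ge0//; apply: le_ereal_sup_tmp; exists 0 => //.
exists (x, x) => //=; rewrite /enorm subrr big1 ?sqrtr0// => i _.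
by rewrite mxE expr0n.
Qed.

Lemma hausdorff_outer0 : hausdorff_outer set0 = 0.
Proof.
apply/eqP; rewrite eq_le; apply/andP; split.
  apply: ge_ereal_sup => _ [d _ <-].
  by rewrite (cover_outer0 (hausdorff_weight0 d) (hausdorff_weight_ge0 d)).
apply: le_ereal_sup_tmp; exists 0 => //; exists 1%R => /=; first exact: ltr01.
exact: (cover_outer0 (hausdorff_weight0 _) (hausdorff_weight_ge0 _)).
Qed.

Lemma hausdorff_outer_ge0 A : 0 <= hausdorff_outer A.
Proof.
apply: le_ereal_sup_tmp; exists (cover_outer (hausdorff_weight 1%R) A).
  by exists 1%R => /=; first exact: ltr01.
exact: (cover_outer_ge0 (hausdorff_weight_ge0 _)).
Qed.

Lemma le_hausdorff_outer : {homo hausdorff_outer : A B / A `<=` B >-> A <= B}.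
Proof.
move=> A B AB; apply: ge_ereal_sup => _ [d /= d0 <-].
apply: le_trans (le_cover_outer (hausdorff_weight d) AB) _.
by apply: ereal_sup_ubound; exists d.
Qed.

Lemma hausdorff_outer_sigma_subadditive : sigma_subadditive hausdorff_outer.
Proof.
move=> F; apply: ge_ereal_sup => _ [d /= d0 <-].
apply: le_trans (cover_outer_sigma_subadditive (hausdorff_weight_ge0 d) F) _.
apply: lee_nneseries => k *.
  exact: (cover_outer_ge0 (hausdorff_weight_ge0 d)).
by apply: ereal_sup_ubound; exists d.
Qed.

HB.instance Definition _ := isOuterMeasure.Build R 'rV[R]_n.+1 hausdorff_outer
  hausdorff_outer0 hausdorff_outer_ge0 le_hausdorff_outer
  hausdorff_outer_sigma_subadditive.

(* Surface measure on hypersurfaces; counting measure on R^1 (n = 0). *)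
Definition surface_measure :
    {measure set (caratheodory_type hausdorff_outer) -> \bar R} :=
  let mu : {outer_measure set 'rV[R]_n.+1 -> \bar R} := hausdorff_outer in
  mu : set (caratheodory_type mu) -> \bar R.

End hausdorff.

Section C11_domain.
Context (R : realType).

Definition C11 n (phi : 'rV[R]_n -> R) : Prop :=
  (forall x, differentiable phi x) /\
  exists K : R, forall x y v : 'rV[R]_n,
    `|'d phi x v - 'd phi y v| <= K * enorm (x - y) * enorm v.

(* Near each boundary point, Omega is the part above the graph of a C^{1,1}
   function in some orthonormal coordinates y = x Q, the vertical coordinate
   being y_0. By cut-off, phi may be taken to be defined on all of R^n. *)
Definition C11_boundary n (Omega : set 'rV[R]_n.+1) : Prop :=
  forall z, boundary Omega z ->
  exists (Q : 'M[R]_n.+1) (phi : 'rV[R]_n -> R) (r : R),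
    [/\ Q *m Q^T = 1%:M, C11 phi, 0 < r &
        forall x, enorm (x - z) < r ->
          (Omega x <->
           phi (\row_(i < n) (x *m Q) 0 (lift ord0 i)) < (x *m Q) 0 ord0)].

Definition bounded_C11_domain n (Omega : set 'rV[R]_n.+1) : Prop :=
  [/\ Omega !=set0, open Omega, connected Omega, bounded_set Omega &
      C11_boundary Omega].

End C11_domain.

Section green.
Context (R : realType) (n : nat) (Omega : set 'rV[R]_n.+1).
Implicit Types (G DG : 'rV[R]_n.+1 -> 'rV[R]_n.+1 -> R)
  (u psi h : 'rV[R]_n.+1 -> R) (s gamma : R).

Local Notation E := 'rV[R]_n.+1.
Local Notation leb := (@lebesgue_Rn R n).
Local Notation sigma := (@surface_measure R n).
Local Notation lebT := (caratheodory_type (@lebesgue_outer R n)).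
Local Notation surfT := (caratheodory_type (@hausdorff_outer R n)).
Local Notation delta := (bdist Omega).
Local Notation bd := (boundary Omega).

Definition green_profile s gamma (x y : E) : R :=
  (enorm (x - y) `^ (n.+1%:R - 2 * s))^-1 *
  Num.min (delta x * delta y / enorm (x - y) ^+ 2) 1 `^ gamma.

Definition green_kernel s gamma G : Prop :=
  [/\ measurable_fun (Omega `*` Omega : set (lebT * lebT)%type)
        (fun p : lebT * lebT => G p.1 p.2),
      forall x y, Omega x -> Omega y -> G x y = G y x &
      exists2 C : R, 0 < C & forall x y, Omega x -> Omega y -> x != y ->
        C^-1 * green_profile s gamma x y <= G x y <=
        C * green_profile s gamma x y].

Definition green_op G (f : E -> R) (x : E) : R :=
  \int[leb]_(y in Omega) (G x y * f y).

Definition is_normal_derivative gamma G DG : Prop :=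
  measurable_fun (bd `*` Omega : set (surfT * lebT)%type)
    (fun p : surfT * lebT => DG p.1 p.2) /\
  forall z, bd z -> forall x_ : nat -> E,
    (forall j, Omega (x_ j)) -> x_ @ \oo --> z ->
    {ae leb, forall y, Omega y ->
      (fun j => G (x_ j) y / delta (x_ j) `^ gamma) @ \oo --> DG z y}.

Definition normal_trace gamma u (z : E) : R :=
  lim ((fun x => u x / delta x `^ gamma) @ within Omega (nbhs z)).

Definition L1loc u : Prop :=
  measurable_fun (Omega : set lebT) (u : lebT -> R) /\
  forall K : set E, compact K -> K `<=` Omega ->
    leb.-integrable K (EFin \o u).

Definition Linfty_c psi : Prop :=
  [/\ measurable_fun (Omega : set lebT) (psi : lebT -> R),
      exists M : R, forall x, Omega x -> `|psi x| <= M &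
      exists K : set E, [/\ compact K, K `<=` Omega &
        forall x, Omega x -> ~ K x -> psi x = 0]].

Definition is_solution gamma G h u : Prop :=
  L1loc u /\
  forall psi, Linfty_c psi ->
    \int[leb]_(x in Omega) (u x * psi x) =
    \int[sigma]_(z in bd) (h z * normal_trace gamma (green_op G psi) z).

Definition ustar DG (x : E) : R := \int[sigma]_(z in bd) DG z x.

(* The quotient being defined is part of the statement that it converges. *)
Definition uniform_boundary_ratio_limit u v h : Prop :=
  forall e : R, 0 < e -> exists2 r : R, 0 < r &
    {ae leb, forall x, Omega x -> forall theta, bd theta ->
      enorm (x - theta) < r -> v x != 0 /\ `|u x / v x - h theta| < e}.

End green.

(* Main.v *)
Require Import Defs.
From HB Require Import structures.
From mathcomp Require Import all_boot all_order all_algebra.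
From mathcomp Require Import all_classical all_reals all_analysis.
From mathcomp Require Import measurable_realfun.
From mathcomp Require Import ring lra.

Set Implicit Arguments.
Unset Strict Implicit.
Unset Printing Implicit Defensive.

Import Order.TTheory GRing.Theory Num.Theory.
Import numFieldNormedType.Exports.

Local Open Scope classical_set_scope.
Local Open Scope ring_scope.

(* The representation u(y) = int_bd h(z) DG(z,y) dz gives the solution, and the
   sign of the difference of two solutions on compact subsets of Omega gives its
   uniqueness. Letting x tend to z in the bounds on G(x,y) / delta(x)^gamma yields
   DG(z,y) ~ delta(y)^gamma / |z - y|^p with p = n + 1 - 2 s + 2 gamma, for almost
   every y. Since the boundary has surface measure at least c t^n in the balls of
   radius t centred on it, u*(y) >= c delta(y)^(gamma - tau) where
   tau = 1 - 2 s + 2 gamma > 0. In u(y) - h(theta) u*(y), the points z near theta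
   contribute at most e u*(y) by continuity of h, and the others only
   O(delta(y)^gamma), which is o(u*(y)). *)

(** * The Euclidean norm *)

(** The bounds on [DG] hold, for each [z], outside a null set of [y] that depends on [z], whereas
    the integrals over the boundary require them for almost every [z] at a fixed [y]. Tonelli
    exchanges the two quantifiers, given joint measurability and the finiteness of the measures of
    [boundary Omega] and [Omega]; the same finiteness carries the Fubini argument that makes the
    Poisson integral a solution. Both measures come from outer measures by Carathéodory's
    construction, so even open sets must be shown measurable: Hausdorff outer measure is additive on
    sets at positive distance, and boxes split along coordinate hyperplanes. Area bounds come from
    charts: from above by cutting a Lipschitz graph into small patches, from below because the
    projection to the base does not increase distances. The exponent p arises because the Green
    profile, divided by delta(x)^gamma, becomes delta(y)^gamma / |x - y|^(n + 1 - 2 s + 2 gamma)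
    once delta(x) is small, and tau is p - n, where n is the dimension of the boundary. The
    assumption gamma > s - 1/2 says exactly that tau > 0. *)

Lemma subr_coord (R : pzRingType) n (x y : 'rV[R]_n) i : (x - y) 0 i = x 0 i - y 0 i.
Proof. by rewrite !mxE. Qed.

Section euclidean_norm.
Context (R : realType) (n : nat).
Implicit Types x y z : 'rV[R]_n.

Lemma enorm_ge0 x : 0 <= enorm x.
Proof. exact: sqrtr_ge0. Qed.

Lemma sqr_enorm x : enorm x ^+ 2 = \sum_(i < n) x 0 i ^+ 2.
Proof. by rewrite sqr_sqrtr// sumr_ge0// => i _; rewrite sqr_ge0. Qed.

Lemma enormN x : enorm (- x) = enorm x.
Proof. by rewrite /enorm; under eq_bigr do rewrite mxE sqrrN. Qed.

Lemma enorm_distC x y : enorm (x - y) = enorm (y - x).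
Proof. by rewrite -enormN opprB. Qed.

Lemma enorm0 : enorm (0 : 'rV[R]_n) = 0.
Proof. by rewrite /enorm big1 ?sqrtr0// => i _; rewrite mxE expr0n. Qed.

Lemma enorm_coord x i : `|x 0 i| <= enorm x.
Proof.
rewrite -(@ler_pXn2r _ 2)// ?nnegrE ?enorm_ge0// sqr_enorm real_normK ?num_real//.
by rewrite (bigD1 i)//= lerDl sumr_ge0// => j _; rewrite sqr_ge0.
Qed.

Lemma enorm_dist_coord x y i : `|x 0 i - y 0 i| <= enorm (x - y).
Proof. by rewrite -subr_coord; exact: enorm_coord. Qed.

Lemma enorm_eq0 x : enorm x = 0 -> x = 0.
Proof.
move=> x0; apply/rowP => i; rewrite mxE; apply/normr0_eq0/le_anti.
by rewrite normr_ge0 andbT -x0 enorm_coord.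
Qed.

Lemma enorm_gt0 x : x != 0 -> 0 < enorm x.
Proof.
move=> x0; rewrite lt_neqAle enorm_ge0 andbT eq_sym.
by apply: contra_neq x0 => /enorm_eq0.
Qed.

Lemma norm_le_enorm x : `|x| <= enorm x.
Proof.
rewrite [leLHS]mx_normrE; apply: bigmax_le; first exact: enorm_ge0.
by move=> -[i j] _ /=; rewrite (ord1 i) enorm_coord.
Qed.

Lemma coord_le_norm x i : `|x 0 i| <= `|x|.
Proof.
rewrite [leRHS]mx_normrE; exact: (@le_bigmax _ _ _ 0 (fun ij => `|x ij.1 ij.2|) (0, i)).
Qed.

Lemma enorm_le_bound x (c : R) : (forall i, `|x 0 i| <= c) -> enorm x <= n%:R * c.
Proof.
case: (posnP n) => [n0 _|n0 xc].
  have -> : x = 0 by apply/rowP => i; exfalso; move: (ltn_ord i); rewrite {2}n0.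
  by rewrite enorm0 n0 mul0r.
have c0 : 0 <= c by exact: le_trans (xc (Ordinal n0)).
rewrite -(@ler_pXn2r _ 2)// ?nnegrE ?enorm_ge0// ?mulr_ge0// sqr_enorm.
apply: (@le_trans _ _ (\sum_(i < n) c ^+ 2)).
  apply: ler_sum => i _; rewrite -(real_normK (num_real (x 0 i))).
  by rewrite ler_pXn2r ?nnegrE.
rewrite sumr_const card_ord exprMn -[leLHS]mulr_natl ler_wpM2r ?sqr_ge0//.
by rewrite -natrX ler_nat -{1}(expn1 n) leq_pexp2l.
Qed.

Lemma enorm_le_norm x : enorm x <= n%:R * `|x|.
Proof. by apply: enorm_le_bound => i; exact: coord_le_norm. Qed.

Lemma enormD x y : enorm (x + y) <= enorm x + enorm y.
Proof.
have [->|x0] := eqVneq x 0; first by rewrite enorm0 !add0r.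
have [->|y0] := eqVneq y 0; first by rewrite enorm0 !addr0.
move: x0 y0 => /enorm_gt0 x0 /enorm_gt0 y0.
rewrite -(@ler_pXn2r _ 2)// ?nnegrE ?addr_ge0 ?enorm_ge0//.
rewrite sqrrD 2!sqr_enorm.
suff xy : \sum_(i < n) x 0 i * y 0 i <= enorm x * enorm y.
  rewrite (_ : \sum_(i < n) _ = \sum_(i < n) x 0 i ^+ 2 +
      (\sum_(i < n) x 0 i * y 0 i) *+ 2 + \sum_(i < n) y 0 i ^+ 2); last first.
    rewrite -sumrMnl -!big_split/=; apply: eq_bigr => i _.
    by rewrite mxE sqrrD.
  by rewrite (sqr_enorm y) lerD2r lerD2l lerMn2r xy.
(* AM-GM with the weights that make it sharp *)
apply: (@le_trans _ _ (\sum_(i < n)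
   (enorm y / enorm x / 2 * x 0 i ^+ 2 + enorm x / enorm y / 2 * y 0 i ^+ 2))).
  apply: ler_sum => i _; rewrite -subr_ge0.
  rewrite (_ : _ - _ = (enorm y * x 0 i - enorm x * y 0 i) ^+ 2 /
      (2 * enorm x * enorm y)); last by field; rewrite !gt_eqF.
  by rewrite divr_ge0 ?sqr_ge0// !mulr_ge0 ?enorm_ge0.
rewrite big_split/= -!mulr_sumr -!sqr_enorm le_eqVlt; apply/orP; left.
by apply/eqP; field; rewrite !gt_eqF.
Qed.

Lemma enorm_dist_triangle y x z : enorm (x - z) <= enorm (x - y) + enorm (y - z).
Proof. by apply: le_trans (enormD _ _); rewrite addrA subrK. Qed.

Lemma enormZ (a : R) x : enorm (a *: x) = `|a| * enorm x.
Proof.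
rewrite /enorm; under eq_bigr do rewrite mxE exprMn.
by rewrite -mulr_sumr sqrtrM ?sqr_ge0// sqrtr_sqr.
Qed.

Lemma nbhs_enormP x (A : set 'rV[R]_n) :
  nbhs x A <-> exists2 r : R, 0 < r & forall y, enorm (y - x) < r -> A y.
Proof.
split=> [/nbhs_ballP[r /= r0 rA]|[r r0 rA]].
  exists r => // y yr; apply: rA; rewrite -ball_normE/= distrC.
  exact: le_lt_trans (norm_le_enorm _) yr.
(* Dividing by n + 1 rather than n keeps the radius meaningful in dimension 0. *)
apply/nbhs_ballP; exists (r / n.+1%:R) => /=; first by rewrite divr_gt0.
move=> y; rewrite -ball_normE/= distrC => yr; apply: rA.
apply: le_lt_trans (enorm_le_norm _) _.
apply: (@le_lt_trans _ _ (n.+1%:R * `|y - x|)).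
  by rewrite ler_wpM2r// ler_nat.
by rewrite mulrC -ltr_pdivlMr.
Qed.

Lemma ler_dist_enorm x y : `|enorm x - enorm y| <= enorm (x - y).
Proof.
rewrite ler_norml lerBlDr lerNl opprB lerBlDr; apply/andP; split.
  by rewrite (enorm_distC x y); apply: le_trans (enormD _ _); rewrite subrK.
by apply: le_trans (enormD _ _); rewrite subrK.
Qed.

Lemma enorm_lipschitz_continuous (f : 'rV[R]_n -> R) (L : R) :
  (forall x y, `|f x - f y| <= L * enorm (x - y)) -> continuous f.
Proof.
move=> fL x; apply/(@cvgrPdist_lt _ _ _ _ (nbhs_filter x)) => e e0; near=> y.
rewrite distrC.
apply: le_lt_trans (fL _ _) _.
have : enorm (y - x) < e / (`|L| + 1).
  near: y; apply/nbhs_enormP; exists (e / (`|L| + 1)) => //.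
  by rewrite divr_gt0// ltr_wpDl.
rewrite ltr_pdivlMr ?ltr_wpDl// mulrC; apply: le_lt_trans.
by rewrite ler_wpM2r ?enorm_ge0// (le_trans (ler_norm L)) ?lerDl.
Unshelve. all: by end_near. Qed.

Lemma enorm_continuous : continuous (@enorm R n).
Proof.
by apply: (@enorm_lipschitz_continuous _ 1) => x y; rewrite mul1r ler_dist_enorm.
Qed.

Lemma enorm_mulmx_orth (Q : 'M[R]_n) x : Q *m Q^T = 1%:M -> enorm (x *m Q) = enorm x.
Proof.
move=> Q1; rewrite /enorm; congr Num.sqrt.
have E z : \sum_(i < n) z 0 i ^+ 2 = (z *m z^T) 0 0.
  by rewrite mxE; apply: eq_bigr => i _; rewrite mxE expr2.
by rewrite 2!E trmx_mul mulmxA -(mulmxA x) Q1 mulmx1.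
Qed.

Lemma nbhs_enorm_ball x (r : R) : 0 < r -> nbhs x [set y | enorm (y - x) < r].
Proof. by move=> r0; apply/nbhs_enormP; exists r. Qed.

End euclidean_norm.

Definition eball (R : realType) n (z : 'rV[R]_n) (t : R) : set 'rV[R]_n :=
  [set x | enorm (x - z) < t].

(** If P K failed, the sets A with P (K \ A) would form a proper filter containing K. A cluster
    point of it in K has a neighbourhood U with P U, so the complement of U belongs to the filter,
    yet U must meet it. This replaces the extraction of finite subcovers in all the local-to-global
    arguments below. *)
Lemma compact_local_prop (T : topologicalType) (K : set T) (P : set T -> Prop) :
  compact K -> P set0 -> (forall A B, P A -> P B -> P (A `|` B)) ->
  (forall A B, A `<=` B -> P B -> P A) ->
  (forall x, K x -> exists2 U, nbhs x U & P U) -> P K.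
Proof.
move=> cK P0 PU PS PK; have [//|nPK] := pselect (P K); exfalso.
pose F := [set A | P (K `\` A)] : set_system T.
have FF : Filter F.
  split.
  - by rewrite /F /= setDT.
  - move=> A B PA PB; rewrite /F/= setDIr; exact: PU.
  - by move=> A B AB; apply: PS; exact: setDS.
have PF : ProperFilter F.
  split => //; rewrite /F/= setD0; exact: nPK.
have FK : F K by rewrite /F/= setDv.
have [x [Kx cx]] := cK F PF FK.
have [U xU PU'] := PK _ Kx.
have FU : F (~` U) by apply: PS PU'; rewrite setDE setCK => ? [].
by have [y [Uy yU]] := cx _ _ FU xU.
Qed.

(** * Measurability for metric outer measures *)

Section metric_outer_measure.
Context (R : realType) (n : nat).
Variable mu : {outer_measure set 'rV[R]_n -> \bar R}.
Hypothesis mu_sep : forall (A B : set 'rV[R]_n) (e : R), 0 < e ->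
  (forall x y, A x -> B y -> e <= enorm (x - y)) ->
  (mu A + mu B <= mu (A `|` B))%E.
Variable g : 'rV[R]_n -> R.
Hypothesis g_lip : forall x y, `|g x - g y| <= enorm (x - y).
Local Open Scope ereal_scope.

Let sep_level (A B : set 'rV[R]_n) (s t : R) : (s < t)%R ->
  (forall x, A x -> (g x <= s)%R) -> (forall x, B x -> (t <= g x)%R) ->
  mu A + mu B <= mu (A `|` B).
Proof.
move=> st As Bt; apply: (@mu_sep _ _ (t - s)); first by rewrite subr_gt0.
move=> x y Ax By; apply: le_trans (g_lip x y); rewrite distrC.
by apply: le_trans (ler_norm _); rewrite lerB ?As ?Bt.
Qed.

(** Carathéodory's argument for metric outer measures. Since g is 1-Lipschitz, {g <= 0} and {g >= a
    k} are at positive distance, and mu is additive on subsets of them. What remains between the two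
    levels is covered by the rings from some index on, whose measures are the tail of a convergent
    series. *)
Lemma lipschitz_sublevel_caratheodory : mu.-caratheodory [set x | (g x <= 0)%R].
Proof.
apply: le_caratheodory_measurable => X.
have [->|Xoo] := eqVneq (mu X) +oo; first by rewrite leey.
have {}Xoo : mu X < +oo by rewrite ltey.
pose a (k : nat) : R := (k.+1%:R^-1)%R.
have a_lt k l : (k < l)%N -> (a l < a k)%R.
  by move=> kl; rewrite ltf_pV2 ?posrE// ltr_nat ltnS.
have a_gt0 k : (0 < a k)%R by rewrite invr_gt0.
pose A k := X `&` [set x | (a k <= g x)%R].
(* Rings two apart lie at positive distance from each other, so the measures of
   the rings are summable. *)
pose F k := X `&` [set x | (a k.+1 <= g x)%R /\ (g x < a k)%R].
have AX k : mu (A k) <= mu X by apply: le_outer_measure => x [].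
have alt b m : (0 < b)%N ->
    \sum_(j < m) mu (F (j.*2 + b)%N) <= mu (A (m.*2 + b).-1).
  move=> b0; elim: m => [|m IH]; first by rewrite big_ord0 outer_measure_ge0.
  rewrite big_ord_recr/=.
  apply: le_trans (leeD2r _ IH) _.
  rewrite addSn.
  have mb0 : (0 < m.*2 + b)%N by rewrite addn_gt0 b0 orbT.
  rewrite addeC; apply: le_trans (@sep_level _ _ (a (m.*2 + b)%N)
      (a (m.*2 + b).-1) _ _ _) _.
  - by apply: a_lt; rewrite prednK.
  - by move=> x [_ [_ /ltW]].
  - by move=> x [].
  - apply: le_outer_measure => x [[Xx []]//|[Xx /= ax]]; split => //=.
    by apply: le_trans ax; apply/ltW/a_lt; rewrite prednK.
have sumF m : \sum_(i < m.*2) mu (F i.+1) <= mu X + mu X.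
  have -> : \sum_(i < m.*2) mu (F i.+1) =
      \sum_(j < m) mu (F (j.*2 + 1)%N) + \sum_(j < m) mu (F (j.*2 + 2)%N).
    elim: m => [|m IH]; first by rewrite !big_ord0 adde0.
    by rewrite doubleS !big_ord_recr/= IH addn1 addn2 -addeA addeACA.
  by apply: leeD; exact: le_trans (alt _ _ _) (AX _).
have Foo : \sum_(0 <= k <oo) mu (F k.+1) < +oo.
  apply: (@le_lt_trans _ _ (mu X + mu X)); last by rewrite lte_add_pinfty.
  apply: lime_le; first by apply: is_cvg_nneseries => *; exact: outer_measure_ge0.
  apply: nearW => m; apply: le_trans (sumF m); rewrite big_mkord.
  rewrite -!(big_mkord xpredT (fun i => mu (F i.+1))).
  by apply: lee_sum_nneg_natr; rewrite -?addnn ?leq_addr.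
have tail := nneseries_tail_cvg Foo (fun k _ => outer_measure_ge0 mu _).
have key N : mu (X `&` [set x | (g x <= 0)%R]) + mu (X `&` ~` [set x | (g x <= 0)%R])
    <= mu X + \sum_(N <= k <oo) mu (F k.+1).
  have : mu (X `&` ~` [set x | (g x <= 0)%R]) <=
      mu (A N.+1) + \sum_(N <= k <oo) mu (F k.+1).
    apply: le_trans (leeD2l _ (outer_measure_sigma_subadditive_tail _ _ _)).
    apply: le_trans (outer_measureU2 _ _ _); apply: le_outer_measure.
    move=> x [Xx /= /negP]; rewrite -ltNge => gx0.
    have [aN|aN] := leP (a N.+1) (g x); [by left; split|right].
    have ex : exists k, (a k <= g x)%R.
      have := near_infty_natSinv_lt (PosNum gx0) => -[k _ /(_ k (leqnn k))/= kg].
      by exists k; exact: ltW.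
    have aM k l : (k <= l)%N -> (a l <= a k)%R.
      by move=> kl; rewrite lef_pV2 ?posrE// ler_nat.
    have NP k : (a k <= g x)%R -> (N.+1 < k)%N.
      move=> ak; rewrite ltnNge; apply/negP => /aM aNk.
      by move: (lt_le_trans aN aNk); rewrite ltNge ak.
    (* The first index with a k <= g x locates the ring of x. It has the form j + 2 with N <= j, and
       x lies in F j.+1. *)
    case: (ex_minnP ex) => -[|k] ak kmin; first by have := NP _ ak.
    have := NP _ ak; rewrite ltnS => Nk.
    case: k => // k in ak kmin Nk *.
    exists k; first by rewrite /=; apply/negP; rewrite -leqNgt.
    split => //; split => //=.
    by rewrite ltNge; apply/negP => /kmin; rewrite ltnn.
  move/(leeD2l (mu (X `&` [set x | (g x <= 0)%R])))/le_trans; apply.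
  rewrite addeA leeD2r//.
  apply: le_trans (@sep_level _ _ 0%R (a N.+1) _ _ _) _ => //.
  - by move=> x [].
  - by move=> x [].
  - by apply: le_outer_measure => x [[]|[]].
rewrite -[leRHS]adde0.
have c : (fun N => mu X + \sum_(N <= k <oo) mu (F k.+1)) @ \oo --> mu X + 0.
  apply: cvgeD => //; last exact: cvg_cst.
  by rewrite fin_num_adde_defl.
rewrite -(cvg_lim _ c)//; apply: lime_ge; last exact: nearW.
by apply/cvg_ex; eexists; exact: c.
Qed.

End metric_outer_measure.

(** Cutting each member of a cover of X by A and by B gives covers of the two parts. It is applied
    to separated sets with the Hausdorff weight, and to a half-space and its complement with the
    volume of boxes. *)
Lemma cover_outer_split (R : realType) (T : pointedType) (w : set T -> \bar R)
    (A B X : set T) :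
  (forall F, 0 <= w F)%E ->
  (forall F, w (F `&` A) + w (F `&` B) <= w F)%E ->
  (cover_outer w (X `&` A) + cover_outer w (X `&` B) <= cover_outer w X)%E.
Proof.
move=> w0 wAB; apply: le_ereal_inf_tmp => _ [F /= XF <-].
apply: (@le_trans _ _ (\sum_(k <oo) (w (F k `&` A) + w (F k `&` B)))%E); last first.
  by apply: lee_nneseries => // k *; rewrite adde_ge0.
rewrite nneseriesD//; apply: leeD; apply: ereal_inf_lbound;
  [exists (fun k => F k `&` A)|exists (fun k => F k `&` B)] => //=.
  by rewrite -setI_bigcupl; exact: setSI.
by rewrite -setI_bigcupl; exact: setSI.
Qed.

Definition halfspace (R : realType) n (i : 'I_n) (c : R) : set 'rV[R]_n :=
  fun x => x 0 i <= c.

Section open_measurable.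
Context d (T : measurableType d) (R : realType) (n : nat) (f : T -> 'rV[R]_n).
Hypothesis mf : forall (i : 'I_n) (c : R), measurable (f @^-1` halfspace i c).

Let mcoord i : measurable_fun setT (fun t => f t 0 i).
Proof.
apply: (measurability _ (RGenOInfty.measurableE R)) => _ [_ [c ->] <-].
rewrite setTI (_ : _ @^-1` _ = ~` (f @^-1` halfspace i c)).
  exact: measurableC.
by apply/seteqP; split => t /=; rewrite in_itv/= andbT ltNge => /negP.
Qed.

(** An open set is a countable union of cubes with rational centres and half-sides 1/(k+1), and each
    cube is a finite intersection of conditions on coordinates. The map f lets one proof serve the
    identity for both Carathéodory sigma-algebras and the difference of two points on their
    product. *)
Lemma open_coord_measurable (U : set 'rV[R]_n) : open U -> measurable (f @^-1` U).
Proof.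
move=> oU.
pose q_ (q : 'rV[rat]_n) : 'rV[R]_n := map_mx ratr q.
pose C (qk : 'rV[rat]_n * nat) : set 'rV[R]_n :=
  [set x | forall i, `|x 0 i - q_ qk.1 0 i| < qk.2.+1%:R^-1].
have -> : U = \bigcup_(qk in [set qk | C qk `<=` U]) C qk.
  apply/seteqP; split => [x Ux|x [qk /= CU]]; last exact: CU.
  have /nbhs_ballP[e /= e0 eU] : nbhs x U by exact: open_nbhs_nbhs.
  have := near_infty_natSinv_lt (PosNum (divr_gt0 e0 (ltr0Sn R 1))).
  move=> -[k _ /(_ k (leqnn k))/= ke].
  have qP i : exists q : rat, `|x 0 i - ratr q| < k.+1%:R^-1.
    have [q qx] : exists q, ratr q \in `](x 0 i - k.+1%:R^-1), (x 0 i + k.+1%:R^-1)[.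
      by apply: rat_in_itvoo; rewrite ltrD2l (@lt_trans _ _ 0)// oppr_lt0.
    exists q; move: qx; rewrite in_itv/= => /andP[? ?].
    by rewrite ltr_distlC; apply/andP; split; rewrite // -ltrBlDr.
  pose q : 'rV[rat]_n := \row_i projT1 (cid (qP i)).
  have Cq : C (q, k) x by move=> i /=; rewrite !mxE; exact: (projT2 (cid (qP i))).
  exists (q, k) => //= y Cy; apply: eU; rewrite -ball_normE/=.
  apply: (@le_lt_trans _ _ (k.+1%:R^-1 + k.+1%:R^-1)); last first.
    by move: ke; rewrite ltr_pdivlMr// mulr_natr mulr2n.
  rewrite [leLHS]mx_normrE; apply: bigmax_le; first by rewrite addr_ge0.
  move=> -[i j] _ /=; rewrite (ord1 i) !mxE.
  have := Cq j; have := Cy j; rewrite /= => Cyj Cqj.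
  rewrite (_ : x 0 j - y 0 j = (x 0 j - q_ q 0 j) - (y 0 j - q_ q 0 j)); last by ring.
  by apply: le_trans (ler_normB _ _) _; rewrite lerD// ltW.
rewrite preimage_bigcup bigcup_mkcond; apply: countable_bigcupT_measurable.
  exact: countableP.
move=> qk; case: ifPn => // _.
have -> : f @^-1` C qk = \bigcap_(i in [set: 'I_n])
    [set t | `|f t 0 i - q_ qk.1 0 i| < qk.2.+1%:R^-1].
  by apply/seteqP; split => t /= h i; [move=> _; exact: h|exact: h].
apply: fin_bigcap_measurable; first exact: finite_finset.
move=> i _; rewrite -[X in measurable X]setTI.
have m : measurable_fun setT (fun t => `|f t 0 i - q_ qk.1 0 i| < qk.2.+1%:R^-1).
  apply: measurable_fun_ltr => //.
  by apply: measurableT_comp => //; exact: measurable_funB.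
exact: (m measurableT [set true]).
Qed.

Lemma continuous_coord_measurable (g : 'rV[R]_n -> R) :
  continuous g -> measurable_fun setT (g \o f).
Proof.
move=> cg; apply: (measurability _ (RGenOpens.measurableE R)) => _ [_ [a [b ->]] <-].
rewrite setTI comp_preimage; apply: open_coord_measurable.
by apply: open_comp => // x _; exact: cg.
Qed.

End open_measurable.

(** * Open sets are measurable for the Hausdorff and Lebesgue outer measures *)

Section borel_caratheodory.
Context (R : realType) (n : nat).
Implicit Types (A : set 'rV[R]_n.+1) (i : 'I_n.+1) (c : R).

Lemma hausdorff_weightS (d : R) A B : A `<=` B ->
  (hausdorff_weight d A <= hausdorff_weight d B)%E.
Proof.
move=> AB; have [A0|/eqP/set0P[x Ax]] := pselect (A = set0).
  by rewrite {1}/hausdorff_weight asboolT ?hausdorff_weight_ge0.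
have B0 : B <> set0 by apply/eqP/set0P; exists x; exact: AB.
have A0 : A <> set0 by apply/eqP/set0P; exists x.
have dAB : (diam A <= diam B)%E.
  by apply: le_ereal_sup => _ [xy /= [? ?] <-]; exists xy => //; split; exact: AB.
have dA0 : (0 <= diam A)%E.
  by apply: le_ereal_sup_tmp; exists 0%E => //; exists (x, x) => //=; rewrite subrr enorm0.
rewrite /hausdorff_weight !asboolF//.
case: ifPn => dA; case: ifPn => dB; rewrite ?leey//; last first.
  by rewrite (le_trans dAB dB) in dA.
rewrite lee_fin ler_wpM2l ?ball_vol_ge0// lerXn2r ?nnegrE//.
- by rewrite divr_ge0// fine_ge0.
- by rewrite divr_ge0// fine_ge0// (le_trans dA0).
- rewrite ler_pM2r// fine_le// ge0_fin_numE// ?(le_trans dA0)//.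
    by rewrite (le_lt_trans dAB)// (le_lt_trans dB)// ltry.
  by rewrite (le_lt_trans dB)// ltry.
Qed.

(** A set of diameter less than e cannot meet both A and B, so at such a scale the weight splits
    over the two sets. Lowering the scale only increases the infimum over covers, hence two
    independent scales for A and B can be replaced by a common one that is at most e / 2. *)
Lemma hausdorff_outer_separated A B (e : R) : 0 < e ->
  (forall x y, A x -> B y -> e <= enorm (x - y)) ->
  (hausdorff_outer A + hausdorff_outer B <= hausdorff_outer (A `|` B))%E.
Proof.
move=> e0 AB.
have cvr_mono (d d' : R) (X : set 'rV[R]_n.+1) : d <= d' ->
    (cover_outer (hausdorff_weight d') X <= cover_outer (hausdorff_weight d) X)%E.
  move=> dd'; apply: le_ereal_inf_tmp => _ [F /= XF <-].
  apply: le_trans (_ : _ <= \sum_(k <oo) hausdorff_weight d' (F k))%E _.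
    by apply: ereal_inf_lbound; exists F.
  apply: lee_nneseries => [k *|k _]; first exact: hausdorff_weight_ge0.
  rewrite /hausdorff_weight; case: asboolP => // _.
  case: ifPn => h; case: ifPn => // h'; rewrite ?leey//.
  by rewrite (le_trans h') ?lee_fin in h.
have H0 := @hausdorff_outer_ge0 R n.
have key (d1 d2 : R) : 0 < d1 -> 0 < d2 ->
    (cover_outer (hausdorff_weight d1) A + cover_outer (hausdorff_weight d2) B
      <= hausdorff_outer (A `|` B))%E.
  move=> d10 d20; pose d := Num.min (Num.min d1 d2) (e / 2).
  have d0 : 0 < d by rewrite !lt_min d10 d20 divr_gt0.
  apply: (@le_trans _ _ (cover_outer (hausdorff_weight d) (A `|` B))); last first.
    by apply: ereal_sup_ubound; exists d.
  apply: le_trans (leeD (@cvr_mono d d1 A _) (@cvr_mono d d2 B _)) _.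
  - by rewrite !ge_min lexx.
  - by rewrite !ge_min lexx orbT.
  have := @cover_outer_split _ _ (hausdorff_weight d) A B (A `|` B).
  rewrite setUK (setUC A B) setUK; apply; first exact: hausdorff_weight_ge0.
  move=> F; have [dF|dF] := boolP (diam F <= d%:E)%E; last first.
    have F0 : F <> set0.
      move=> F0; move/negP: dF; apply; apply: ge_ereal_sup => ? [xy [+ _] _].
      by rewrite F0.
    by rewrite [leRHS]/hausdorff_weight asboolF// (negbTE dF) leey.
  have [[x [Fx Ax]]|FA] := pselect (exists x, F x /\ A x); last first.
    rewrite (_ : F `&` A = set0) ?hausdorff_weight0 ?add0e; last first.
      by apply/seteqP; split => // x [Fx Ax]; apply: FA; exists x.
    by apply: hausdorff_weightS => x [].
  rewrite (_ : F `&` B = set0) ?hausdorff_weight0 ?adde0; last first.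
    apply/seteqP; split => // y [Fy By]; have := AB _ _ Ax By.
    apply/negP; rewrite -ltNge; apply: (@le_lt_trans _ _ d); last first.
      by rewrite !gt_min; apply/orP; right; rewrite ltr_pdivrMr// ltr_pMr// ltr1n.
    rewrite -lee_fin; apply: le_trans dF; apply: ereal_sup_ubound.
    by exists (x, y).
  by apply: hausdorff_weightS => z [].
have sup_le (S S' : set (\bar R)) (z : \bar R) : S !=set0 -> S' !=set0 ->
    (forall s, S s -> 0 <= s)%E -> (forall s, S' s -> 0 <= s)%E ->
    (forall s t, S s -> S' t -> s + t <= z)%E -> (ereal_sup S + ereal_sup S' <= z)%E.
  move=> [s0 Ss0] [t0 S't0] S0 S'0 SS'.
  have z0 : (0 <= z)%E.
    by apply: le_trans (SS' _ _ Ss0 S't0); exact: adde_ge0 (S0 _ Ss0) (S'0 _ S't0).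
  have [->|zoo] := eqVneq z +oo%E; first by rewrite leey.
  have zfin : z \is a fin_num by rewrite ge0_fin_numE// ltey.
  have h s : S s -> (s + ereal_sup S' <= z)%E.
    move=> Ss; have sfin : s \is a fin_num.
      rewrite ge0_fin_numE ?S0//; apply: le_lt_trans (_ : z < +oo)%E; last by rewrite ltey.
      by apply: le_trans (SS' _ _ Ss S't0); rewrite leeDl// S'0.
    rewrite addeC -leeBrDr//; apply: ge_ereal_sup => t S't.
    by rewrite leeBrDr// addeC SS'.
  have S'fin : ereal_sup S' \is a fin_num.
    rewrite ge0_fin_numE; last first.
      by apply: le_trans (S'0 _ S't0) _; exact: ereal_sup_ubound.
    apply: le_lt_trans (_ : z < +oo)%E; last by rewrite ltey.
    by apply: le_trans (h _ Ss0); rewrite leeDr// S0.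
  by rewrite -leeBrDr//; apply: ge_ereal_sup => s Ss; rewrite leeBrDr// h.
apply: sup_le.
- by exists (cover_outer (hausdorff_weight 1) A), 1 => //=.
- by exists (cover_outer (hausdorff_weight 1) B), 1 => //=.
- by move=> _ [d _ <-]; apply: cover_outer_ge0; exact: hausdorff_weight_ge0.
- by move=> _ [d _ <-]; apply: cover_outer_ge0; exact: hausdorff_weight_ge0.
- by move=> _ _ [d /= d0 <-] [d' /= d'0 <-]; exact: key.
Qed.

Lemma halfspace_hausdorff_measurable i c :
  (@hausdorff_outer R n).-caratheodory (halfspace i c).
Proof.
have -> : halfspace i c = [set x | x 0 i - c <= 0].
  by apply/seteqP; split => x /=; rewrite subr_le0.
apply: (@lipschitz_sublevel_caratheodory _ _ (@hausdorff_outer R n)).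
  exact: hausdorff_outer_separated.
move=> x y; rewrite (_ : x 0 i - c - _ = (x - y) 0 i); last by rewrite !mxE; ring.
exact: enorm_coord.
Qed.

(** A hyperplane x_i = c that crosses a box cuts it into two boxes whose volumes add up to that of
    the box. If it misses the box, one of the two parts of F is empty. *)
Lemma box_vol_split i c (F : set 'rV[R]_n.+1) :
  (box_vol (F `&` halfspace i c) + box_vol (F `&` ~` halfspace i c)
   <= box_vol F)%E.
Proof.
apply: le_ereal_inf_tmp => _ [[a b] /= [ab Fab] <-].
pose b' : 'rV[R]_n.+1 := \row_j (if j == i then Num.min (b 0 j) c else b 0 j).
pose a' : 'rV[R]_n.+1 := \row_j (if j == i then Num.max (a 0 j) c else a 0 j).
have prodE (u v : 'rV[R]_n.+1) : (forall j, j != i -> v 0 j - u 0 j = b 0 j - a 0 j) ->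
    \prod_(j < n.+1) (v 0 j - u 0 j) =
    (v 0 i - u 0 i) * \prod_(j < n.+1 | j != i) (b 0 j - a 0 j).
  by move=> uv; rewrite (bigD1 i)//=; congr (_ * _); exact: eq_bigr.
have vol_le (u v : 'rV[R]_n.+1) G : (forall j, u 0 j <= v 0 j) -> G `<=` box u v ->
    (box_vol G <= (\prod_(j < n.+1) (v 0 j - u 0 j))%:E)%E.
  by move=> uv Guv; apply: ereal_inf_lbound; exists (u, v).
have [ca|ac] := ltP c (a 0 i).
  rewrite (_ : _ `&` _ = set0) ?box_vol0 ?add0e; last first.
    apply/seteqP; split => // x [/Fab/(_ i)/andP[ax _]] /= xc.
    by move: (lt_le_trans ca ax); rewrite ltNge xc.
  by apply: vol_le => // x [/Fab].
have [bc|cb] := ltP (b 0 i) c.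
  rewrite addeC (_ : _ `&` _ = set0) ?box_vol0 ?add0e; last first.
    apply/seteqP; split => // x [/Fab/(_ i)/andP[_ xb]] /=; apply.
    exact: le_trans xb (ltW bc).
  by apply: vol_le => // x [/Fab].
apply: le_trans (leeD (@vol_le a b' _ _ _) (@vol_le a' b _ _ _)) _.
- by move=> j; rewrite mxE; case: ifPn => // /eqP ->; rewrite le_min ab ac.
- move=> x [/Fab xab /= xc] j; rewrite mxE; case: ifPn => [/eqP ->|_]; last exact: xab.
  by rewrite le_min xc; have /andP[-> ->] := xab i.
- by move=> j; rewrite mxE; case: ifPn => // /eqP ->; rewrite ge_max ab cb.
- move=> x [/Fab xab /= /negP]; rewrite -ltNge => xc j; rewrite mxE.
  case: ifPn => [/eqP ->|_]; last exact: xab.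
  by rewrite ge_max (ltW xc); have /andP[-> ->] := xab i.
rewrite -EFinD lee_fin (@prodE a b') => [|j /negbTE ji]; last by rewrite mxE ji.
rewrite (@prodE a' b) => [|j /negbTE ji]; last by rewrite mxE ji.
rewrite (@prodE a b)// -mulrDl !mxE eqxx (min_idPr cb) (max_idPr ac).
by rewrite le_eqVlt; apply/orP; left; apply/eqP; congr (_ * _); ring.
Qed.

Lemma halfspace_lebesgue_measurable i c :
  (@lebesgue_outer R n).-caratheodory (halfspace i c).
Proof.
apply: le_caratheodory_measurable => X; apply: cover_outer_split.
  exact: box_vol_ge0.
exact: box_vol_split.
Qed.

Local Notation lebT := (caratheodory_type (@lebesgue_outer R n)).
Local Notation surfT := (caratheodory_type (@hausdorff_outer R n)).

Lemma open_lebesgue_measurable (U : set 'rV[R]_n.+1) : open U -> measurable (U : set lebT).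
Proof.
move=> oU.
exact: (@open_coord_measurable _ lebT R n.+1 (fun x : lebT => x : 'rV[R]_n.+1)
  halfspace_lebesgue_measurable).
Qed.

Lemma open_surface_measurable (U : set 'rV[R]_n.+1) : open U -> measurable (U : set surfT).
Proof.
move=> oU.
exact: (@open_coord_measurable _ surfT R n.+1 (fun x : surfT => x : 'rV[R]_n.+1)
  halfspace_hausdorff_measurable).
Qed.

Lemma bounded_lebesgue_lty A : bounded_set A -> (@lebesgue_Rn R n A < +oo)%E.
Proof.
move=> [M [_ MA]].
have {}MA x : A x -> `|x| <= `|M| + 1.
  by apply: MA; rewrite (le_lt_trans (ler_norm M))// ltrDl.
apply: (@le_lt_trans _ _ (box_vol A)).
  apply: le_trans (_ : _ <= \sum_(k <oo) box_vol (if k == 0%N then A else set0))%E _.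
    apply: ereal_inf_lbound; exists (fun k => if k == 0%N then A else set0) => //.
    by move=> x Ax; exists 0%N; rewrite ?eqxx.
  rewrite (nneseries_split _ 1) => [|k _]; last exact: box_vol_ge0.
  rewrite add0n big_nat1 eseries0 ?adde0// => -[|k]// _ _; exact: box_vol0.
apply: le_lt_trans (ltry (\prod_(i < n.+1)
  ((const_mx (`|M| + 1) : 'rV[R]_n.+1) 0 i - (const_mx (- (`|M| + 1)) : 'rV[R]_n.+1) 0 i))).
apply: ereal_inf_lbound; exists (const_mx (- (`|M| + 1)), const_mx (`|M| + 1)) => //.
have M0 : 0 <= `|M| + 1 by rewrite addr_ge0.
split => [i|x Ax i] /=; rewrite !mxE; first by rewrite ge0_cp.
by rewrite -ler_norml (le_trans (coord_le_norm x i))// MA.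
Qed.

End borel_caratheodory.

(** * Surface measure of the boundary *)

Lemma lebesgue_measure_itvcc (R : realType) (x y : R) : x <= y ->
  lebesgue_measure (`[x, y]%classic : set R) = (y - x)%:E.
Proof.
move=> xy; rewrite lebesgue_measure_itv/= lte_fin; case: ltP => [_|yx].
  by rewrite EFinB.
by rewrite (le_anti (_ : x <= y <= x)) ?xy// subrr.
Qed.

(* Induction on the dimension: integrate the lower-dimensional inequality for
   the slices over the last coordinate. *)
Lemma box_cover_volume (R : realType) (n : nat) (a b : nat -> R)
    (l u : nat -> nat -> R) (J : nat -> bool) :
  (forall i, a i <= b i) -> (forall k i, l k i <= u k i) ->
  (forall y : nat -> R, (forall i, (i < n)%N -> a i <= y i <= b i) ->
    exists2 k, J k & forall i, (i < n)%N -> l k i <= y i <= u k i) ->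
  ((\prod_(i < n) (b i - a i))%:E <=
   \sum_(k <oo) ((J k)%:R * \prod_(i < n) (u k i - l k i))%:E)%E.
Proof.
(* Boxes are described by sequences indexed by nat of which the first n entries count, so the same
   data serve every dimension of the induction. *)
move=> ab lu; elim: n J => [|n IH] J cov.
  have [//|k Jk _] := cov (fun=> 0).
  apply: le_trans (nneseries_lim_ge k.+1 _) => [|i _ _]; last first.
    by rewrite lee_fin big_ord0 mulr1.
  rewrite big_nat_recr//= !big_ord0 Jk mulr1 leeDr// sume_ge0// => i _.
  by rewrite big_ord0 mulr1 lee_fin.
pose c k : R := (J k)%:R * \prod_(i < n) (u k i - l k i).
have c0 k : 0 <= c k by rewrite mulr_ge0// prodr_ge0// => i _; rewrite subr_ge0.
pose I k : set R := `[l k n, u k n]%classic.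
pose D : set R := `[a n, b n]%classic.
pose f k (t : R) : \bar R := (c k * \1_(I k) t)%:E.
have mD : measurable D by exact: measurable_itv.
have mI k : measurable (I k) by exact: measurable_itv.
have f0 k t : D t -> (0 <= f k t)%E by move=> _; rewrite lee_fin mulr_ge0.
have mf k : measurable_fun D (f k).
  apply/measurable_EFinP; exact: measurable_funM.
have slice t : D t -> ((\prod_(i < n) (b i - a i))%:E <= \sum_(k <oo) f k t)%E.
  rewrite /D /= in_itv/= => /andP[at_ tb].
  (* The flag J is what the induction varies: at height t, only the boxes whose last interval
     contains t cover the slice. *)
  pose J' k := J k && (l k n <= t <= u k n).
  have /IH : forall y : nat -> R, (forall i, (i < n)%N -> a i <= y i <= b i) ->
      exists2 k, J' k & forall i, (i < n)%N -> l k i <= y i <= u k i.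
    move=> y yab; have [|k Jk kP] := cov (fun i => if i == n then t else y i).
      move=> i; rewrite ltnS leq_eqVlt; case: eqVneq => [-> _|_ /=]; last exact: yab.
      by rewrite at_ tb.
    exists k; first by rewrite /J' Jk; have := kP n (ltnSn n); rewrite eqxx.
    move=> i lin; have := kP i (ltnW lin); rewrite ifN//.
    by rewrite neq_ltn lin.
  move/le_trans; apply; apply: lee_nneseries => [k _ _|k _].
    by rewrite lee_fin mulr_ge0// prodr_ge0// => i _; rewrite subr_ge0.
  rewrite lee_fin /c /J' indicE.
  case: (J k); rewrite /= ?mul0r// mul1r [leRHS]mulrC ler_wpM2r//.
    by apply: prodr_ge0 => i _; rewrite subr_ge0.
  by rewrite ler_nat; case: (boolP (_ <= t <= _)) => // tI; rewrite mem_set// /I/= in_itv.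
have volD : lebesgue_measure D = (b n - a n)%:E := lebesgue_measure_itvcc (ab n).
apply: (@le_trans _ _ (\int[lebesgue_measure]_(t in D) (\prod_(i < n) (b i - a i))%:E)%E).
  by rewrite integral_cst// big_ord_recr/= EFinM -volD.
apply: (@le_trans _ _ (\int[lebesgue_measure]_(t in D) (\sum_(k <oo) f k t))%E).
  apply: ge0_le_integral => //.
  - by move=> t _; rewrite lee_fin prodr_ge0// => i _; rewrite subr_ge0.
  - by apply: ge0_emeasurable_sum => [k t Dt _|k _]; [exact: f0|exact: mf].
rewrite integral_nneseries//.
apply: lee_nneseries => [k _ _|k _]; first by apply: integral_ge0 => t; exact: f0.
rewrite /f; under eq_integral do rewrite EFinM.
rewrite ge0_integralZl//; last 2 first.
- apply/measurable_EFinP; apply: measurable_indic; exact: mI.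
- by rewrite lee_fin.
rewrite big_ord_recr/= mulrA -/(c k) [leRHS](EFinM (c k)).
apply: lee_wpmul2l; rewrite ?lee_fin//.
have -> : (\int[lebesgue_measure]_(x in D) (\1_(I k) x)%:E =
    lebesgue_measure (I k `&` D))%E by apply: integral_indic; [exact: mD|exact: mI].
rewrite -lebesgue_measure_itvcc//; apply: le_measure; rewrite ?inE//.
by apply: measurableI; [exact: mI|exact: mD].
Qed.

Section hausdorff_estimates.
Context (R : realType) (n : nat).
Implicit Types S : set 'rV[R]_n.+1.

Lemma ball_vol_gt0 k : 0 < ball_vol R k.
Proof.
suff : 0 < ball_vol R k /\ 0 < ball_vol R k.+1 by case.
elim: k => [//|k [k0 k1]]; split => //.
by rewrite /= mulr_gt0// divr_gt0// mulr_gt0// pi_gt0.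
Qed.

Lemma diam_ge0 S x : S x -> (0 <= diam S)%E.
Proof.
move=> Sx; apply: le_ereal_sup_tmp; exists 0%E => //.
by exists (x, x) => //=; rewrite subrr enorm0.
Qed.

(** Under P, a set of diameter d goes into a cube of half-side d around the image of any of its
    points. A cover of S thus yields boxes covering a cube of half-side rho, and volumes can be
    compared. The single scale 1 is enough for a lower bound, the Hausdorff measure being a supremum
    over scales. *)
Lemma le_hausdorff_outer_projection S (P : 'rV[R]_n.+1 -> 'rV[R]_n)
    (p : 'rV[R]_n) (rho : R) :
  0 <= rho ->
  (forall x y i, `|P x 0 i - P y 0 i| <= enorm (x - y)) ->
  (forall y : 'rV[R]_n, (forall i, `|y 0 i - p 0 i| <= rho) -> exists2 x, S x & P x = y) ->
  ((ball_vol R n * (rho / 2) ^+ n)%:E <= hausdorff_outer S)%E.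
Proof.
move=> rho0 P1 PS.
apply: (@le_trans _ _ (cover_outer (hausdorff_weight 1) S)); last first.
  by apply: ereal_sup_ubound; exists 1 => //=.
apply: le_ereal_inf_tmp => _ [F /= SF <-].
have w0 := @hausdorff_weight_ge0 R n 1.
have [[k koo]|Ffin] := pselect (exists k, hausdorff_weight 1 (F k) = +oo%E).
  apply: le_trans (nneseries_lim_ge k.+1 _) => [|//].
  by rewrite big_nat_recr//= koo addey ?leey// gt_eqF// (lt_le_trans _ (sume_ge0 _ _)).
have Fd k x : F k x -> hausdorff_weight 1 (F k) =
    (ball_vol R n * (fine (diam (F k)) / 2) ^+ n)%:E /\ (diam (F k) \is a fin_num).
  move=> Fx; have F0 : F k <> set0 by apply/eqP/set0P; exists x.
  have : hausdorff_weight 1 (F k) <> +oo%E by move=> h; apply: Ffin; exists k.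
  rewrite /hausdorff_weight asboolF//; case: ifPn => // d1 _; split => //.
  by rewrite ge0_fin_numE ?(diam_ge0 Fx)// (le_lt_trans d1)// ltry.
pose crd (y : 'rV[R]_n) (i : nat) := if insub i is Some j then y 0 j else 0.
have crdE y (i : 'I_n) : crd y i = y 0 i by rewrite /crd valK.
pose xx k := if pselect (exists x, F k x) is left h then projT1 (cid h) else 0.
have xxP k x : F k x -> F k (xx k).
  by move=> Fx; rewrite /xx; case: pselect => [h|[]]; [case: cid|exists x].
pose d k : R := fine (diam (F k)).
have d0 k : 0 <= d k.
  have [F0|/eqP/set0P[x Fx]] := pselect (F k = set0); last first.
    by rewrite fine_ge0// (diam_ge0 Fx).
  rewrite /d F0 /diam (_ : (_ @` _) = set0) ?ereal_sup0//.
  by apply/seteqP; split => // ? [? [+ _] _].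
(* Each box is centred at the projection of a chosen point [xx k] of [F k]. Empty members have no
   such point and are discarded by the flag; their weight is 0. *)
have := @box_cover_volume R n (fun i => crd p i - rho) (fun i => crd p i + rho)
  (fun k i => crd (P (xx k)) i - d k) (fun k i => crd (P (xx k)) i + d k)
  (fun k => `[< F k !=set0 >]) _ _ _.
(* The volume (2 r)^n is written 4^n (r / 2)^n to match the normalization of the Hausdorff weight,
   so that 4^n cancels on both sides. *)
have prodE (x : nat -> R) (r : R) :
    \prod_(i < n) (x i + r - (x i - r)) = 4 ^+ n * (r / 2) ^+ n.
  rewrite -exprMn (eq_bigr (fun=> 2 * r)) => [|i _]; last by ring.
  by rewrite prodr_const card_ord; congr (_ ^+ _); field.
rewrite prodE; under eq_eseriesr do rewrite prodE.
move=> h; have {}h := h _ _ _; rewrite -(@lee_pmul2l _ (4 ^+ n)%:E) ?lte_fin ?exprn_gt0//.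
rewrite -EFinM mulrCA EFinM.
apply: le_trans (lee_wpmul2l _ (h _ _ _)) _ => [||||{h}].
- by rewrite lee_fin ball_vol_ge0.
- by move=> i; rewrite lerD2l ge0_cp.
- by move=> k i; rewrite lerD2l ge0_cp.
- move=> y yp; have [i|x Sx Pxy] := PS (\row_i y i).
    by have := yp i (ltn_ord i); rewrite crdE mxE ler_distl.
  have [k _ Fx] := SF _ Sx; exists k; first by apply/asboolP; exists x.
  move=> i lin; have -> : y i = P x 0 (Ordinal lin) by rewrite Pxy mxE.
  rewrite (crdE _ (Ordinal lin)) -ler_distlC; apply: le_trans (P1 _ _ _) _.
  rewrite -lee_fin fineK; last by have [] := Fd _ _ Fx.
  by apply: ereal_sup_ubound; exists (xx k, x) => //=; split => //; exact: xxP Fx.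
rewrite -!nneseriesZl//; last first.
  by move=> k _; rewrite lee_fin !mulr_ge0// !exprn_ge0// divr_ge0.
apply: lee_nneseries => [k _ _|k _].
  by rewrite -EFinM lee_fin !mulr_ge0// ?ball_vol_ge0// !exprn_ge0// divr_ge0.
case: asboolP => [[x Fx]|_]; last first.
  by rewrite mul0r mule0 mule_ge0// lee_fin exprn_ge0.
by have [-> _] := Fd _ _ Fx; rewrite -!EFinM lee_fin mul1r mulrCA.
Qed.

Lemma cover_outer_fin (T : pointedType) (w : set T -> \bar R) (I : finType)
    (F : I -> set T) (A : set T) :
  w set0 = 0%E -> (forall B, 0 <= w B)%E -> A `<=` \bigcup_i F i ->
  (cover_outer w A <= \sum_i w (F i))%E.
Proof.
move=> w00 w0 AF.
pose F' k := if insub k is Some i then F (enum_val (i : 'I_#|I|)) else set0.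
apply: (@le_trans _ _ (\sum_(k <oo) w (F' k))%E).
  apply: ereal_inf_lbound; exists F' => // x /AF[i _ Fx]; exists (enum_rank i) => //.
  by rewrite /F' valK enum_rankK.
rewrite (nneseries_split _ #|I|)// add0n eseries0 ?adde0; last first.
  by move=> k kI _; rewrite /F' insubN// -leqNgt.
rewrite big_mkord (reindex (enum_val : 'I_#|I| -> I))/=; last first.
  by exists enum_rank => ? _; rewrite ?enum_rankK ?enum_valK.
by apply: lee_sum => i _; rewrite /F' valK.
Qed.

End hausdorff_estimates.

(** * Lipschitz bounds for C^{1,1} functions on balls *)

Section C11_lipschitz.
Context (R : realType) (n : nat) (phi : 'rV[R]_n -> R).

Lemma linear_form_enorm_le (f : {linear 'rV[R]_n -> R}) (v : 'rV[R]_n) :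
  `|f v| <= (\sum_(i < n) `|f (delta_mx 0 i)|) * enorm v.
Proof.
rewrite {1}(row_sum_delta v) linear_sum mulr_suml.
apply: le_trans (ler_norm_sum _ _ _) _; apply: ler_sum => i _.
by rewrite linearZ/= normrM mulrC ler_wpM2l// enorm_coord.
Qed.

Lemma segment_MVT (x w : 'rV[R]_n) : (forall y, differentiable phi y) ->
  exists2 t, 0 <= t <= 1 & phi (x + w) - phi x = 'd phi (x + t *: w) w.
Proof.
move=> dphi; pose f (t : R) := phi (x + t *: w).
have fE t : (fun h : R => h^-1 *: ((f \o shift t) (h *: 1) - f t)) =
    (fun h : R => h^-1 *: ((phi \o shift (x + t *: w)) (h *: w) - phi (x + t *: w))).
  apply/funext => h; rewrite /f/= /shift; congr (_ *: (phi _ - _)).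
  by rewrite [h *: 1]mulr1 scalerDl addrCA addrA.
have df t : is_derive t (1 : R) f ('d phi (x + t *: w) w).
  split; first by rewrite /derivable fE; exact: diff_derivable.
  by rewrite -deriveE// /derive fE.
have cf : {within `[0, 1], continuous f}.
  by apply: derivable_within_continuous => t _; exact: @ex_derive.
have [t] := @MVT_segment R f (fun t => 'd phi (x + t *: w) w) 0 1 ler01
   (fun t _ => df t) cf.
rewrite in_itv/= => t01; rewrite /f scale1r scale0r addr0 subr0 mulr1 => ft.
by exists t.
Qed.

(** Mean value theorem on the segment from y to x, which stays in the ball by convexity. On the ball
    the differential differs from the one at y0 by at most K rho, which accounts for the two terms
    of the constant. *)
Lemma C11_ball_lipschitz (y0 : 'rV[R]_n) (rho : R) : C11 phi ->
  exists2 L : R, 0 <= L & forall x y, enorm (x - y0) <= rho -> enorm (y - y0) <= rho ->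
    `|phi x - phi y| <= L * enorm (x - y).
Proof.
move=> [dphi [K Kphi]].
exists ((\sum_(i < n) `|'d phi y0 (delta_mx 0 i)|) + `|K| * `|rho|).
  by rewrite addr_ge0 ?sumr_ge0// mulr_ge0.
move=> x y xr yr; have [t /andP[t0 t1]] := segment_MVT y (x - y) dphi.
have -> : y + (x - y) = x by rewrite addrC subrK.
move=> ->; set z := y + t *: (x - y).
have zr : enorm (z - y0) <= rho.
  rewrite (_ : z - y0 = (1 - t) *: (y - y0) + t *: (x - y0)); last first.
    by apply/rowP => i; rewrite /z !mxE; ring.
  apply: le_trans (enormD _ _) _; rewrite !enormZ !ger0_norm ?subr_ge0//.
  apply: le_trans (lerD (ler_wpM2l _ yr) (ler_wpM2l t0 xr)) _; rewrite ?subr_ge0//.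
  by rewrite -mulrDl subrK mul1r.
have aux (a b c d : R) : `|b| <= c -> `|a - b| <= d -> `|a| <= c + d.
  by move=> bc abd; rewrite -(subrK b a) addrC; apply: le_trans (ler_normD _ _) (lerD _ _).
apply: le_trans (aux _ _ _ _ (linear_form_enorm_le _ _) (Kphi z y0 (x - y))) _.
rewrite mulrDl lerD2l ler_wpM2r ?enorm_ge0//.
apply: le_trans (ler_wpM2r (enorm_ge0 _) (ler_norm K)) _.
by rewrite ler_wpM2l// (le_trans zr)// ler_norm.
Qed.

End C11_lipschitz.

(** * The boundary in one chart *)

Section chart.
Context (R : realType) (n : nat) (Omega : set 'rV[R]_n.+1) (z0 : 'rV[R]_n.+1)
  (Q : 'M[R]_n.+1) (phi : 'rV[R]_n -> R) (r : R).
Hypotheses (QQ : Q *m Q^T = 1%:M) (Cphi : C11 phi) (r0 : 0 < r)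
  (oOmega : open Omega).

(** Height of x over the base of the chart; [P x] is its base point, and [g] recovers a point from
    base point and height, Q^T being the inverse of Q. *)
Let H (x : 'rV[R]_n.+1) : R := (x *m Q) 0 ord0.
Let P (x : 'rV[R]_n.+1) : 'rV[R]_n := \row_(i < n) (x *m Q) 0 (lift ord0 i).
Hypothesis chart : forall x, enorm (x - z0) < r -> (Omega x <-> phi (P x) < H x).

Let g (y : 'rV[R]_n) (t : R) : 'rV[R]_n.+1 :=
  (\row_j (if unlift ord0 j is Some i then y 0 i else t)) *m Q^T.

Let gQ y t : g y t *m Q = \row_j (if unlift ord0 j is Some i then y 0 i else t).
Proof. by rewrite /g -mulmxA (mulmx1C QQ) mulmx1. Qed.

Let Hg y t : H (g y t) = t.
Proof. by rewrite /H gQ mxE unlift_none. Qed.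

Let Pg y t : P (g y t) = y.
Proof. by apply/rowP => i; rewrite /P gQ !mxE liftK. Qed.

Let PE x i : P x 0 i = (x *m Q) 0 (lift ord0 i).
Proof. by rewrite [LHS]mxE. Qed.

Let sqr_enormHP x y :
  enorm (x - y) ^+ 2 = (H x - H y) ^+ 2 + enorm (P x - P y) ^+ 2.
Proof.
rewrite -(enorm_mulmx_orth (x - y) QQ) mulmxBl !sqr_enorm big_ord_recl subr_coord.
by congr (_ + _); apply: eq_bigr => i _; rewrite !subr_coord !PE.
Qed.

Let enormP x y : enorm (P x - P y) <= enorm (x - y).
Proof.
by rewrite -(@ler_pXn2r _ 2)// ?nnegrE ?enorm_ge0// sqr_enormHP lerDr sqr_ge0.
Qed.

Let enormHP x y : enorm (x - y) <= `|H x - H y| + enorm (P x - P y).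
Proof.
rewrite -(@ler_pXn2r _ 2)// ?nnegrE ?addr_ge0 ?enorm_ge0// sqr_enormHP.
rewrite -(real_normK (num_real (H x - H y))) sqrrD -addrA lerD2l lerDr.
by rewrite mulrn_wge0// mulr_ge0 ?enorm_ge0.
Qed.

(** A defining function: near [z0], Omega is the set where F is positive. *)
Let F x : R := H x - phi (P x).

Let F_cts x : exists2 L : R, 0 <= L &
  forall y, enorm (y - x) <= 1 -> `|F y - F x| <= L * enorm (y - x).
Proof.
have [L L0 phiL] := C11_ball_lipschitz (P x) 1 Cphi.
exists (1 + L); first by rewrite addr_ge0.
move=> y yx1; rewrite /F (_ : _ - _ = (H y - H x) - (phi (P y) - phi (P x))); last by ring.
apply: le_trans (ler_normB _ _) _; rewrite mulrDl mul1r lerD//.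
  rewrite -(@ler_pXn2r _ 2)// ?nnegrE ?enorm_ge0//.
  by rewrite sqr_enormHP real_normK ?num_real// lerDl sqr_ge0.
apply: le_trans (phiL _ _ _ _) _.
- exact: le_trans (enormP _ _) yx1.
- by rewrite subrr enorm0.
- by rewrite ler_wpM2l.
Qed.

(** A boundary point has F <= 0 because Omega is open, and F >= 0 because F < 0 would persist on a
    neighbourhood, which would then miss Omega. Conversely, raising a point of the graph by a small
    height t enters Omega, while the point itself is outside. *)
Lemma chart_boundaryE x : enorm (x - z0) < r ->
  (boundary Omega x <-> H x = phi (P x)).
Proof.
move=> xr; split => [[clx nix]|Hx].
  apply/eqP; rewrite eq_le; apply/andP; split.
    rewrite leNgt; apply/negP => /(chart xr) Ox; apply: nix.
    by move: oOmega; rewrite openE; apply.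
  rewrite leNgt; apply/negP => HP.
  have F0 : 0 < - F x by rewrite /F opprB subr_gt0.
  have [L L0 FL] := F_cts x.
  pose e := Num.min (Num.min 1 (r - enorm (x - z0))) (- F x / (L + 1)).
  have e0 : 0 < e by rewrite !lt_min ltr01 subr_gt0 xr divr_gt0// ltr_wpDl.
  have [y [Oy /=]] := clx _ (nbhs_enorm_ball x e0).
  rewrite !lt_min -andbA => /and3P[y1 yr yF].
  have yz0 : enorm (y - z0) < r.
    by apply: le_lt_trans (enorm_dist_triangle x _ _) _; rewrite -ltrBrDr.
  move/(chart yz0): Oy; rewrite -subr_gt0 -/(F y) ltNge => /negP; apply.
  have := FL _ (ltW y1); rewrite ler_distl => /andP[_ Fy].
  apply: le_trans Fy _; rewrite -(opprK (F x)) addrC subr_le0.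
  move: yF; rewrite ltr_pdivlMr ?ltr_wpDl// mulrC mulrDl mul1r => /ltW; apply: le_trans.
  by rewrite lerDl enorm_ge0.
split; last first.
  move=> /interior_subset /(chart xr); by rewrite Hx ltxx.
move=> A /nbhs_enormP[e e0 eA].
pose t := Num.min e (r - enorm (x - z0)) / 2.
have t0 : 0 < t by rewrite divr_gt0// lt_min e0 subr_gt0.
have tm : t < Num.min e (r - enorm (x - z0)).
  by rewrite /t ltr_pdivrMr// ltr_pMr ?ltr1n// lt_min e0 subr_gt0.
move: tm; rewrite lt_min => /andP[te tr].
pose y := g (P x) (H x + t).
have yx : enorm (y - x) <= t.
  apply: le_trans (enormHP _ _) _; rewrite /y Hg Pg subrr enorm0 addr0.
  by rewrite addrC addKr gtr0_norm.
exists y; split; last by apply: eA; exact: le_lt_trans te.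
apply/chart.
  apply: le_lt_trans (enorm_dist_triangle x _ _) _; rewrite -ltrBrDr.
  exact: le_lt_trans tr.
by rewrite /y Hg Pg -Hx ltrDl.
Qed.

(** The base cube of half-side r is cut into M^n subcubes. The graph over each has diameter at most
    2 (1 + L) n r / M, so the weights of these M^n patches add up to at most c, whatever M is; M is
    then taken large enough for the scale d. *)
Lemma chart_surface_lty :
  (hausdorff_outer (boundary Omega `&` eball z0 r) < +oo)%E.
Proof.
have [L L0 phiL] := C11_ball_lipschitz (P z0) (n%:R * r) Cphi.
pose c : R := ball_vol R n * ((1 + L) * (n%:R * r)) ^+ n.
apply: (@le_lt_trans _ _ c%:E); last exact: ltry.
apply: ge_ereal_sup => _ [d /= d0 <-].
have [M [M0 Md]] : exists M : nat, (0 < M)%N /\ (1 + L) * (n%:R * r) * 2 <= d * M%:R.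
  set v := _ * _ * _; have v0 : 0 <= v by rewrite !mulr_ge0 ?addr_ge0// ltW.
  exists (Num.bound (v / d)).+1; split => //; rewrite -ler_pdivrMl// mulrC.
  apply: le_trans (ltW (archi_boundP _)) _; first by rewrite divr_ge0// ltW.
  by rewrite ler_nat.
pose I := {ffun 'I_n -> 'I_M}.
pose p (f : I) (i : 'I_n) : R := P z0 0 i - r + r * 2 / M%:R * (f i)%:R.
pose B (f : I) : set 'rV[R]_n.+1 := [set x |
  (forall i, p f i <= P x 0 i <= p f i + r * 2 / M%:R) /\ H x = phi (P x)
   /\ enorm (P x - P z0) <= n%:R * r].
apply: (@le_trans _ _ (\sum_(f : I) hausdorff_weight d (B f))%E).
  apply: cover_outer_fin.
  - exact: hausdorff_weight0.
  - exact: hausdorff_weight_ge0.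
  - move=> x [bx xr]; have Hx := (chart_boundaryE xr).1 bx.
    have Pxr i : `|P x 0 i - P z0 0 i| < r.
      exact: le_lt_trans (enorm_dist_coord _ _ _) (le_lt_trans (enormP _ _) xr).
    (* The index of the subcube is the integer part of the rescaled coordinate; it is below M
       because the coordinate differs from that of [P z0] by strictly less than r. *)
    have ex i : exists m : 'I_M, r * 2 / M%:R * m%:R <= P x 0 i - P z0 0 i + r
       <= r * 2 / M%:R * m%:R + r * 2 / M%:R.
      have M0' : 0 < M%:R :> R by rewrite ltr0n.
      have s0 : 0 < r * 2 / M%:R by rewrite divr_gt0// mulr_gt0.
      set v := _ - _ + r; have v0 : 0 <= v / (r * 2 / M%:R).
        by rewrite divr_ge0 ?(ltW s0)// /v; have := Pxr i; rewrite ltr_norml; lra.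
      have /andP[m1 m2] := truncn_itv v0.
      have mM : (Num.truncn (v / (r * 2 / M%:R)) < M)%N.
        rewrite -(ltr_nat R); apply: le_lt_trans m1 _; rewrite ltr_pdivrMr//.
        rewrite mulrCA divff ?gt_eqF// mulr1.
        by rewrite /v; have := Pxr i; rewrite ltr_norml; lra.
      exists (Ordinal mM) => /=; rewrite -[X in _ <= _ <= _ + X]mulr1 -mulrDr natr1.
      by rewrite 2!(mulrC (r * 2 / M%:R)) -ler_pdivlMr// m1 -ler_pdivrMr// ltW.
    exists [ffun i => projT1 (cid (ex i))] => //; split.
      move=> i; rewrite /p ffunE; move: (projT2 (cid (ex i))) => /=.
      by move=> /andP[? ?]; apply/andP; split; lra.
    split => //; apply: enorm_le_bound => i.
    by rewrite subr_coord ltW.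
have wB f : (hausdorff_weight d (B f) <=
    (ball_vol R n * ((1 + L) * (n%:R * r) / M%:R) ^+ n)%:E)%E.
  have c0 : 0 <= (1 + L) * (n%:R * r) / M%:R.
    by rewrite divr_ge0// mulr_ge0 ?addr_ge0// mulr_ge0// ltW.
  rewrite /hausdorff_weight; case: asboolP => [_|/eqP/set0P[x0 Bx0]].
    by rewrite lee_fin mulr_ge0 ?ball_vol_ge0// exprn_ge0.
  have dB : (diam (B f) <= ((1 + L) * (n%:R * r) / M%:R * 2)%:E)%E.
    apply: ge_ereal_sup => _ [[x y] /= [[xp [Hx xr]] [yp [Hy yr]]] <-].
    rewrite lee_fin; apply: le_trans (enormHP _ _) _; rewrite Hx Hy.
    apply: (@le_trans _ _ ((1 + L) * enorm (P x - P y))).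
      by rewrite mulrDl mul1r addrC lerD2l phiL.
    rewrite -!mulrA ler_wpM2l ?addr_ge0//; apply: enorm_le_bound => i.
    have /andP[x1 x2] := xp i; have /andP[y1 y2] := yp i; rewrite subr_coord.
    by rewrite ler_norml mulrA mulrAC; apply/andP; split; lra.
  rewrite ifT; last first.
    apply: le_trans dB _; rewrite lee_fin mulrAC ler_pdivrMr// ltr0n//.
  rewrite lee_fin ler_wpM2l ?ball_vol_ge0// lerXn2r ?nnegrE//.
    by rewrite divr_ge0// fine_ge0// (diam_ge0 Bx0).
  rewrite ler_pdivrMr// -lee_fin fineK// ge0_fin_numE ?(diam_ge0 Bx0)//.
  by rewrite (le_lt_trans dB)// ltry.
apply: le_trans (lee_sum _ (fun f _ => wB f)) _.
rewrite sumEFin lee_fin sumr_const card_ffun !card_ord -[leLHS]mulr_natl natrX.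
rewrite mulrCA -exprMn (_ : M%:R * _ = (1 + L) * (n%:R * r)) ?lexx//.
by field; rewrite pnatr_eq0 -lt0n.
Qed.

(** The part of the graph above the cube of half-side t / k around [P z] lies in the ball of radius
    t about z and projects onto that cube. Requiring z within r / 2 of [z0] and t <= r / 2 keeps
    this ball inside the chart. *)
Lemma chart_surface_ge : exists2 c : R, 0 < c & forall (z : 'rV[R]_n.+1) (t : R),
  boundary Omega z -> enorm (z - z0) < r / 2 -> 0 < t <= r / 2 ->
  ((c * t ^+ n)%:E <=
   hausdorff_outer (boundary Omega `&` eball z t))%E.
Proof.
have [L L0 phiL] := C11_ball_lipschitz (P z0) r Cphi.
(* In the cube of half-side t / k the base point moves by at most n t / k, so the graph point moves
   by at most (1 + L) n t / k = t n / (2 (n + 1)) < t. The factor n + 1 keeps k positive when n =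
   0. *)
pose k : R := 2 * (1 + L) * n.+1%:R.
have k0 : 0 < k by rewrite !mulr_gt0// ltr_wpDr.
exists (ball_vol R n * (1 / k / 2) ^+ n).
  by rewrite mulr_gt0 ?ball_vol_gt0// exprn_gt0// !divr_gt0.
move=> z t bz zr /andP[t0 tr].
have zr' : enorm (z - z0) < r by lra.
have Hz := (chart_boundaryE zr').1 bz.
rewrite -mulrA -exprMn (_ : 1 / k / 2 * t = t / k / 2); last by ring.
apply: (@le_hausdorff_outer_projection _ _ _ P (P z)).
- by rewrite divr_ge0// ltW.
- move=> x y i; exact: le_trans (enorm_dist_coord _ _ _) (enormP _ _).
move=> y yz; exists (g y (phi y)); last exact: Pg.
have yPz : enorm (y - P z) <= n%:R * (t / k).
  by apply: enorm_le_bound => i; rewrite subr_coord; exact: yz.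
have kt : (1 + L) * enorm (y - P z) < t.
  apply: (@le_lt_trans _ _ ((1 + L) * (n%:R * (t / k)))).
    by rewrite ler_wpM2l// addr_ge0.
  rewrite (_ : _ * _ = t * (n%:R / (2 * n.+1%:R))); last first.
    by rewrite /k; field; rewrite nat1r pnatr_eq0/= gt_eqF// ltr_wpDr.
  by rewrite gtr_pMr// ltr_pdivrMr// mul1r -natrM ltr_nat mul2n -addnn ltn_addr.
have yt : enorm (y - P z) < t.
  by apply: le_lt_trans kt; rewrite ler_peMl ?enorm_ge0// lerDl.
have gz : enorm (g y (phi y) - z) < t.
  apply: le_lt_trans (enormHP _ _) _; rewrite Hg Pg Hz.
  apply: le_lt_trans kt; rewrite mulrDl mul1r addrC lerD2l; apply: phiL.
    apply: le_trans (enorm_dist_triangle (P z) _ _) _.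
    by have := enormP z z0; lra.
  by have := enormP z z0; lra.
split => //; apply/chart_boundaryE; last by rewrite Hg Pg.
by apply: le_lt_trans (enorm_dist_triangle z _ _) _; lra.
Qed.

End chart.

(** * Area of the boundary, continuous boundary data, and the distance function *)

Section boundary_regularity.
Context (R : realType) (n : nat) (Omega : set 'rV[R]_n.+1).
Local Notation bd := (boundary Omega).

Lemma boundary_closed : closed bd.
Proof.
rewrite /boundary setDE; apply: closedI; first exact: closed_closure.
by apply: open_closedC; exact: open_interior.
Qed.

Hypothesis dom : bounded_C11_domain Omega.

Let oOmega : open Omega. Proof. by case: dom. Qed.
Let bOmega : bounded_set Omega. Proof. by case: dom. Qed.
Let C11b : C11_boundary Omega. Proof. by case: dom. Qed.

Lemma closure_domain_bounded : bounded_set (closure Omega).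
Proof.
have [M [Mr MO]] := bOmega.
exists (`|M| + 1); split; first exact: num_real.
move=> M' MM' x cx; have [y [Oy]] := cx _ (nbhsx_ballx x 1 ltr01).
rewrite -ball_normE/= => xy; rewrite -(subrK y x).
apply: le_trans (ler_normD _ _) _; rewrite -lerBrDl.
have My : `|y| <= M' - 1.
  by apply: MO => //; rewrite ltrBrDr (le_lt_trans _ MM')// lerD2r ler_norm.
by apply: le_trans My _; rewrite lerD2l lerN2 ltW.
Qed.

Lemma boundary_compact : compact bd.
Proof.
apply: bounded_closed_compact; last exact: boundary_closed.
have [M [Mr MO]] := closure_domain_bounded.
by exists M; split => // M' MM' x [cx _]; exact: MO MM' x cx.
Qed.

Lemma boundary_surface_lty : (hausdorff_outer bd < +oo)%E.
Proof.
rewrite -(setIid bd).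
apply: (@compact_local_prop _ bd (fun A => (hausdorff_outer (bd `&` A) < +oo)%E)).
- exact: boundary_compact.
- by rewrite setI0 hausdorff_outer0.
- move=> A B Aoo Boo; rewrite setIUr.
  by apply: le_lt_trans (outer_measureU2 _ _ _) _; rewrite lte_add_pinfty.
- move=> A B AB; apply: le_lt_trans; apply: le_outer_measure; exact: setIS.
move=> z /C11b[Q [phi [r [QQ Cphi r0 chart]]]]; exists (eball z r).
  exact: nbhs_enorm_ball.
exact: chart_surface_lty QQ Cphi r0 oOmega chart.
Qed.

Lemma boundary_surface_ge : exists c r0 : R, [/\ 0 < c, 0 < r0 &
  forall z t, bd z -> 0 < t <= r0 ->
    ((c * t ^+ n)%:E <= hausdorff_outer (bd `&` eball z t))%E].
Proof.
pose P (A : set 'rV[R]_n.+1) := exists c r0 : R, [/\ 0 < c, 0 < r0 &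
  forall z t, A z -> bd z -> 0 < t <= r0 ->
    ((c * t ^+ n)%:E <= hausdorff_outer (bd `&` eball z t))%E].
suff [c [r [c0 r0 h]]] : P bd by exists c, r; split => // z t bz; exact: h.
apply: (compact_local_prop boundary_compact).
- by exists 1, 1.
- move=> A B [c [r [c0 r0 hA]]] [c' [r' [c'0 r'0 hB]]].
  exists (Num.min c c'), (Num.min r r'); split; rewrite ?lt_min ?c0 ?r0//.
  move=> z t ABz bz /andP[t0]; rewrite le_min => /andP[tr tr'].
  have tn : 0 <= t ^+ n by rewrite exprn_ge0// ltW.
  case: ABz => [Az|Bz].
    apply: le_trans (hA _ _ Az bz _); rewrite ?t0 ?tr//.
    by rewrite lee_fin ler_wpM2r// ge_min lexx.
  apply: le_trans (hB _ _ Bz bz _); rewrite ?t0 ?tr'//.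
  by rewrite lee_fin ler_wpM2r// ge_min lexx orbT.
- move=> A B AB [c [r [c0 r0 h]]]; exists c, r; split => // z t /AB; exact: h.
move=> z /C11b[Q [phi [r [QQ Cphi r0 chart]]]]; exists (eball z (r / 2)).
  by apply: nbhs_enorm_ball; rewrite divr_gt0.
have [c c0 h] := chart_surface_ge QQ Cphi oOmega chart.
exists c, (r / 2); split; rewrite ?divr_gt0// => z' t zz' bz' tr.
exact: h.
Qed.

Section continuous_boundary.
Variable h : 'rV[R]_n.+1 -> R.
Hypothesis ch : {within bd, continuous h}.

Let ch_local z (e : R) : bd z -> 0 < e -> exists2 r : R, 0 < r &
  forall y, bd y -> enorm (y - z) < r -> `|h y - h z| < e.
Proof.
move=> bz e0; have /subspace_continuousP/(_ z bz) := ch.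
move=> /cvgrPdist_lt/(_ _ e0)/nbhs_enormP[r r0 rh]; exists r => // y by_ yz.
by rewrite distrC; exact: rh yz by_.
Qed.

Lemma continuous_boundary_bounded : exists2 M : R, 0 <= M & forall z, bd z -> `|h z| <= M.
Proof.
pose P (A : set 'rV[R]_n.+1) :=
  exists2 M : R, 0 <= M & forall z, A z -> bd z -> `|h z| <= M.
suff [M M0 hM] : P bd by exists M => // z bz; exact: hM.
apply: (compact_local_prop boundary_compact).
- by exists 0.
- move=> A B [M M0 hA] [M' M'0 hB]; exists (M + M'); first exact: addr_ge0.
  move=> z [Az|Bz] bz; first by rewrite (le_trans (hA _ Az bz))// lerDl.
  by rewrite (le_trans (hB _ Bz bz))// lerDr.
- by move=> A B AB [M M0 hB]; exists M => // z /AB; exact: hB.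
move=> z bz; have [r r0 hr] := ch_local bz ltr01.
exists (eball z r); first exact: nbhs_enorm_ball.
exists (`|h z| + 1); first by rewrite addr_ge0.
move=> y yz by_; rewrite -(subrK (h z) (h y)) addrC.
by apply: le_trans (ler_normD _ _) _; rewrite lerD2l ltW// hr.
Qed.

Lemma continuous_boundary_uniform (e : R) : 0 < e -> exists2 r : R, 0 < r &
  forall z z', bd z -> bd z' -> enorm (z' - z) < r -> `|h z' - h z| < e.
Proof.
move=> e0; have e20 : 0 < e / 2 by rewrite divr_gt0.
pose P (A : set 'rV[R]_n.+1) := exists2 r : R, 0 < r &
  forall z z', A z -> bd z -> bd z' -> enorm (z' - z) < r -> `|h z' - h z| < e.
suff [r r0 hr] : P bd by exists r => // z z' bz; exact: hr.
apply: (compact_local_prop boundary_compact).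
- by exists 1.
- move=> A B [r r0 hA] [r' r'0 hB]; exists (Num.min r r'); first by rewrite lt_min r0.
  move=> z z' [Az|Bz] bz bz'; rewrite lt_min => /andP[zr zr'].
    exact: hA.
  exact: hB.
- by move=> A B AB [r r0 hB]; exists r => // z z' /AB; exact: hB.
move=> z bz; have [r r0 hr] := ch_local bz e20.
exists (eball z (r / 2)); first by apply: nbhs_enorm_ball; rewrite divr_gt0.
exists (r / 2); first by rewrite divr_gt0.
move=> y y' /= yz by_ by' yy'.
have yr : enorm (y - z) < r by apply: lt_trans yz _; rewrite ltr_pdivrMr// ltr_pMr// ltr1n.
have y'r : enorm (y' - z) < r.
  apply: le_lt_trans (enorm_dist_triangle y _ _) _.
  by rewrite [ltRHS]splitr ltrD.
rewrite (_ : h y' - h y = (h y' - h z) - (h y - h z)); last by ring.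
by apply: le_lt_trans (ler_normB _ _) _; rewrite [ltRHS]splitr ltrD// hr.
Qed.

End continuous_boundary.

Let delta := bdist Omega.

Lemma bdist_lipschitz x y : `|delta x - delta y| <= enorm (x - y).
Proof.
(* With an empty boundary both distances are the infimum of the empty set, hence equal. *)
have [h|h] := pselect (bd !=set0); last first.
  have -> : delta x = delta y.
    congr inf; rewrite (_ : bd = set0) ?image_set0//.
    by apply/seteqP; split => // z bz; apply: h; exists z.
  by rewrite subrr normr0 enorm_ge0.
have key u v : delta u <= delta v + enorm (u - v).
  rewrite -lerBlDr; apply: lb_le_inf; first by have [z bz] := h; exists (enorm (v - z)), z.
  move=> _ [z bz <-]; rewrite lerBlDr addrC; apply: le_trans (enorm_dist_triangle v _ _).
  by apply: ge_inf; [exists 0 => _ [w _ <-]; exact: enorm_ge0|exists z].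
rewrite ler_norml lerBlDr [X in _ && X](_ : _ = true); last by rewrite addrC key.
by rewrite andbT lerNl opprB lerBlDr enorm_distC addrC key.
Qed.

Lemma bdist_le x z : bd z -> delta x <= enorm (x - z).
Proof.
move=> bz; apply: ge_inf; last by exists z.
by exists 0 => _ [w _ <-]; exact: enorm_ge0.
Qed.

Lemma bdist_ge0 x : 0 <= delta x.
Proof.
have [h|h] := pselect ([set enorm (x - z) | z in bd] !=set0).
  by apply: lb_le_inf => // _ [z _ <-]; exact: enorm_ge0.
by rewrite /delta/bdist inf_out// => -[/h].
Qed.

Lemma bdist_near x z e : bd z -> 0 < e -> exists2 z', bd z' & enorm (x - z') < delta x + e.
Proof.
move=> bz e0.
have hi : has_inf [set enorm (x - w) | w in bd].
  by split; [exists (enorm (x - z)), z|exists 0 => _ [w _ <-]; exact: enorm_ge0].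
by have [_ [z' bz' <-] h] := inf_adherent e0 hi; exists z'.
Qed.

(** A ball around x inside the open set Omega contains no boundary point. A boundary point is given
    because the infimum of the empty set is 0 by convention. *)
Lemma bdist_gt0 x z : bd z -> Omega x -> 0 < delta x.
Proof.
move=> bz Ox; have /nbhs_enormP[r r0 rO] : nbhs x Omega by exact: open_nbhs_nbhs.
apply: (lt_le_trans r0); apply: lb_le_inf; first by exists (enorm (x - z)), z.
move=> _ [w [_ nw] <-]; rewrite leNgt; apply/negP => xw; apply: nw.
by move: oOmega; rewrite openE; apply; apply: rO; rewrite enorm_distC.
Qed.

End boundary_regularity.

(** * Integration over sets of finite measure *)

Lemma ae_mono d (T : measurableType d) (R : realType) (mu : {measure set T -> \bar R})
    (P Q : T -> Prop) :
  {ae mu, forall x, P x} -> (forall x, P x -> Q x) -> {ae mu, forall x, Q x}.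
Proof. by move=> aeP PQ; apply: filterS aeP. Qed.

Lemma ae_and d (T : measurableType d) (R : realType) (mu : {measure set T -> \bar R})
    (P Q : T -> Prop) :
  {ae mu, forall x, P x} -> {ae mu, forall x, Q x} -> {ae mu, forall x, P x /\ Q x}.
Proof. by move=> aeP aeQ; apply: filterI aeP aeQ. Qed.

Section finite_restriction.
Context d (T : measurableType d) (R : realType).
Variables (mu : {measure set T -> \bar R}) (D : set T).
Hypotheses (mD : measurable D) (muD : (mu D < +oo)%E).
Local Open Scope ereal_scope.

(** Restricting mu to D turns it into a finite measure on the whole type, as the Fubini and Tonelli
    theorems ask for sigma-finite measures; surface measure on all of space is not known to be one
    here. *)
Definition restr_measure : {finite_measure set T -> \bar R} := mfrestr mD muD.

Lemma restr_measureE A : restr_measure A = mu (A `&` D).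
Proof. by []. Qed.

Lemma integral_restr_measure (f : T -> \bar R) :
  \int[mu]_(x in D) f x = \int[restr_measure]_x (f \_ D) x.
Proof.
rewrite -integral_mkcond; apply: eq_measure_integral => A mA AD.
transitivity (mu (A `&` D)) => //; congr (mu _).
by apply/esym/setIidPl.
Qed.

Lemma ae_restr_measure (P : T -> Prop) :
  {ae restr_measure, forall x, P x} <-> {ae mu, forall x, D x -> P x}.
Proof.
split=> [[N [mN N0 PN]]|[N [mN N0 PN]]].
  exists (N `&` D); split; [exact: measurableI|by rewrite -restr_measureE|].
  by move=> x /= /not_implyP[Dx nPx]; split => //; exact: PN.
exists (N `|` ~` D); split; first by apply: measurableU => //; exact: measurableC.
  rewrite restr_measureE setIUl setICl setU0.
  by apply: (subset_measure0 _ _ _ N0) => //; exact: measurableI.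
move=> x nPx; have [Dx|nDx] := pselect (D x); [left|by right].
by apply: PN => /= /(_ Dx).
Qed.

End finite_restriction.

Lemma ae_bounded_integrable d (T : measurableType d) (R : realType)
    (mu : {measure set T -> \bar R}) (D : set T) (g : T -> R) (C : R) :
  measurable D -> (mu D < +oo)%E ->
  measurable_fun D g -> {ae mu, forall x, D x -> `|g x| <= C} ->
  mu.-integrable D (EFin \o g) /\
  (\int[mu]_(x in D) `|(g x)%:E| <= `|C|%:E * mu D)%E.
Proof.
move=> mD muD mg gC.
have mEg : measurable_fun D (EFin \o g) by exact/measurable_EFinP.
have le : (\int[mu]_(x in D) `|(EFin \o g) x| <= `|C|%:E * mu D)%E.
  apply: integral_le_bound => //; apply: filterS gC => x gC Dx.
  by rewrite lee_fin (le_trans (gC Dx))// ler_norm.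
split=> //; apply/integrableP; split=> //; apply: le_lt_trans le _.
by rewrite lte_mul_pinfty// lee_fin.
Qed.

Section finite_domain_fubini.
Context d1 d2 (T1 : measurableType d1) (T2 : measurableType d2) (R : realType).
Variables (m1 : {measure set T1 -> \bar R}) (m2 : {measure set T2 -> \bar R}).
Variables (D1 : set T1) (D2 : set T2).
Hypotheses (mD1 : measurable D1) (mD2 : measurable D2).
Hypotheses (fin1 : (m1 D1 < +oo)%E) (fin2 : (m2 D2 < +oo)%E).

Let n1 := restr_measure mD1 fin1.
Let n2 := restr_measure mD2 fin2.

(** The product measure of B within D1 x D2 is the integral of the measures of its sections in
    either direction. Null x-sections make it 0, hence almost every y-section is null. *)
Lemma ae_swap (B : set (T1 * T2)) : measurable B ->
  (forall x, D1 x -> {ae m2, forall y, D2 y -> ~ B (x, y)}) ->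
  {ae m2, forall y, D2 y -> {ae m1, forall x, D1 x -> ~ B (x, y)}}.
Proof.
move=> mB hB; pose B' := B `&` (D1 `*` D2).
have mB' : measurable B' by apply: measurableI => //; exact: measurableX.
have := @indic_fubini_tonelli _ _ _ _ _ n1 n2 B' mB'.
rewrite indic_fubini_tonelli_FE// indic_fubini_tonelli_GE//.
rewrite integral0_eq => [/esym h|x _]; last first.
  rewrite /= restr_measureE.
  have [D1x|nD1x] := pselect (D1 x); last first.
    rewrite (_ : _ `&` _ = set0) ?measure0//; apply/seteqP; split => // y [].
    by rewrite /xsection/= => /set_mem[_ []].
  have [N [mN N0 BN]] := hB _ D1x.
  apply: (subset_measure0 _ mN _ N0).
    by apply: measurableI => //; exact: measurable_xsection.
  move=> y [] /=; rewrite /xsection/= => /set_mem[Bxy [_ D2y]] _.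
  by apply: BN => /= /(_ D2y).
have [N [mN N0 BN]] : {ae n2, forall y, (n1 \o ysection B') y = 0%E}.
  have := (@ae_eq_integral_abs _ _ _ n2 setT measurableT (n1 \o ysection B')
    (measurable_fun_ysection n1 mB')).1.
  move=> h'; have : (\int[n2]_y `|(n1 \o ysection B') y| = 0)%E.
    by rewrite -[RHS]h; apply: eq_integral => y _; rewrite gee0_abs.
  by move/h'; apply: filterS => y /= /(_ Logic.I).
have h1 : {ae n2, forall y, D2 y -> {ae m1, forall x, D1 x -> ~ B (x, y)}}.
  exists N; split => // y nP; apply: BN => /= h0; apply: nP => D2y.
  exists (ysection B' y); split; first exact: measurable_ysection.
    have -> : ysection B' y = ysection B' y `&` D1; last exact: h0.
    apply/seteqP; split => x; last by case.
    by rewrite /ysection/= => /set_mem[Bxy [D1x _]]; split=> //; apply/mem_set.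
  by move=> x /not_implyP[D1x /contrapT Bxy]; rewrite /ysection/=; apply/mem_set.
by apply: filterS ((ae_restr_measure mD2 fin2 _).1 h1) => y h' D2y; exact: h'.
Qed.

Variable f : T1 -> T2 -> R.
Hypothesis mf : measurable_fun (D1 `*` D2) (fun p => f p.1 p.2).

Let F : T1 * T2 -> R := (fun p => f p.1 p.2) \_ (D1 `*` D2).

Let mF : measurable_fun setT F.
Proof. by apply/(measurable_restrictT _ (measurableX mD1 mD2)). Qed.

Let FE1 y : D2 y -> (\int[m1]_(x in D1) (f x y)%:E = \int[n1]_x (F (x, y))%:E)%E.
Proof.
move=> D2y; rewrite (integral_restr_measure mD1 fin1); apply: eq_integral => x _.
rewrite /F !patchE; case: (boolP (x \in D1)) => D1x.
  by rewrite mem_set//; split => //=; exact: set_mem.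
by rewrite memNset// => -[/= /mem_set]; rewrite (negbTE D1x).
Qed.

Let FE2 x : D1 x -> (\int[m2]_(y in D2) (f x y)%:E = \int[n2]_y (F (x, y))%:E)%E.
Proof.
move=> D1x; rewrite (integral_restr_measure mD2 fin2); apply: eq_integral => y _.
rewrite /F !patchE; case: (boolP (y \in D2)) => D2y.
  by rewrite mem_set//; split => //=; exact: set_mem.
by rewrite memNset// => -[/= _ /mem_set]; rewrite (negbTE D2y).
Qed.

Lemma measurable_section1 y : D2 y -> measurable_fun D1 (fun x => f x y).
Proof.
move=> D2y; apply: (eq_measurable_fun (fun x => F (x, y))); last first.
  apply: measurable_funTS.
  by apply: (measurableT_comp mF); exact: pair2_measurable.
move=> x /set_mem D1x; rewrite /F patchE mem_set//.
Qed.

Lemma measurable_section2 x : D1 x -> measurable_fun D2 (f x).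
Proof.
move=> D1x; apply: (eq_measurable_fun (fun y => F (x, y))); last first.
  apply: measurable_funTS.
  by apply: (measurableT_comp mF); exact: pair1_measurable.
move=> y /set_mem D2y; rewrite /F patchE mem_set//.
Qed.

(** Tonelli gives measurability for nonnegative integrands; the integral is the difference of those
    of the positive and negative parts, so no integrability enters. *)
Let measurable_G : measurable_fun setT (fun y => \int[n1]_x (F (x, y))%:E)%E.
Proof.
have mEF : measurable_fun setT (EFin \o F) by exact/measurable_EFinP.
under eq_fun do rewrite integralE.
apply: emeasurable_funB.
  apply: (eq_measurable_fun (fubini_G n1 (EFin \o F)^\+%E)) => [y _|].
    by apply: eq_integral => x _; rewrite !funeposE.
  apply: measurable_fun_fubini_tonelli_G => //; exact: measurable_funepos.
apply: (eq_measurable_fun (fubini_G n1 (EFin \o F)^\-%E)) => [y _|].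
  by apply: eq_integral => x _; rewrite !funenegE.
by apply: measurable_fun_fubini_tonelli_G => //; exact: measurable_funeneg.
Qed.

Lemma measurable_partial_Rintegral :
  measurable_fun D2 (fun y => (\int[m1]_(x in D1) f x y)%R).
Proof.
apply: (eq_measurable_fun (fun y => fine (\int[n1]_x (F (x, y))%:E)%E)).
  by move=> y /set_mem D2y; rewrite /Rintegral FE1.
by apply: measurable_funTS; apply: (measurableT_comp _ measurable_G).
Qed.

Variable C : R.
Hypothesis fC : forall x, D1 x -> {ae m2, forall y, D2 y -> `|f x y| <= C}.

Lemma ae_bounded_section :
  {ae m2, forall y, D2 y -> {ae m1, forall x, D1 x -> `|f x y| <= C}}.
Proof.
have FE x y : D1 x -> D2 y -> F (x, y) = f x y.
  by move=> D1x D2y; rewrite /F patchE mem_set.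
pose B := [set p | C < `|F p|].
have mB : measurable B.
  have m : measurable_fun setT (fun p => C < `|F p|).
    by apply: measurable_fun_ltr => //; exact: measurableT_comp.
  by rewrite -[B]setTI; exact: (m measurableT [set true]).
have := ae_swap mB; move=> /(_ _)/filterS; apply.
  move=> y h D2y; apply: filterS (h D2y) => x h' D1x.
  by have /negP := h' D1x; rewrite /B/= FE// -leNgt.
move=> x D1x; apply: filterS (fC D1x) => y h D2y.
by apply/negP; rewrite FE// -leNgt h.
Qed.

Let ae_partial : {ae m2, forall y, D2 y ->
  (\int[m1]_(x in D1) f x y)%:E = (\int[m1]_(x in D1) (f x y)%:E)%E /\
  (`|(\int[m1]_(x in D1) f x y)|%:E <= `|C|%:E * m1 D1)%E}.
Proof.
apply: filterS ae_bounded_section => y h D2y.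
have [i le] := ae_bounded_integrable mD1 fin1 (measurable_section1 D2y) (h D2y).
split; first by rewrite /Rintegral fineK//; exact: integrable_fin_num.
rewrite EFin_normr_Rintegral//; apply: le_trans le.
by apply: le_abse_integral => //; exact/measurable_EFinP/measurable_section1.
Qed.

Lemma bounded_partial_Rintegral_integrable :
  m2.-integrable D2 (EFin \o (fun y => (\int[m1]_(x in D1) f x y)%R)).
Proof.
apply: (@ae_bounded_integrable _ _ _ _ _ _ (fine (`|C|%:E * m1 D1)%E) mD2 fin2
  measurable_partial_Rintegral _).1.
apply: filterS ae_partial => y h D2y; have [_] := h D2y.
rewrite -lee_fin fineK// ge0_fin_numE ?mule_ge0//.
by rewrite lte_mul_pinfty// lee_fin.
Qed.

(** A bound C on finite measures gives integrability on the product. The real integral over D1 is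
    identified with the extended one for almost every y, which is enough under the outer
    integral. *)
Lemma bounded_Fubini :
  (\int[m2]_(y in D2) (\int[m1]_(x in D1) f x y) =
   \int[m1]_(x in D1) (\int[m2]_(y in D2) f x y))%R.
Proof.
rewrite {1}/Rintegral [RHS]/Rintegral; congr fine.
transitivity (\int[n2]_y \int[n1]_x (F (x, y))%:E)%E.
  transitivity (\int[m2]_(y in D2) (\int[n1]_x (F (x, y))%:E))%E.
    apply: ae_eq_integral => //.
    - exact/measurable_EFinP/measurable_partial_Rintegral.
    - by apply: measurable_funTS; exact: measurable_G.
    - by apply: filterS ae_partial => y h D2y; rewrite (h D2y).1 FE1.
  rewrite (integral_restr_measure mD2 fin2); apply: eq_integral => y _.
  rewrite patchE; case: ifPn => // /negP nD2y; rewrite integral0_eq// => x _.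
  by rewrite /F patchE memNset// => -[_ /= /mem_set].
transitivity (\int[n1]_x \int[n2]_y (F (x, y))%:E)%E; last first.
  rewrite (integral_restr_measure mD1 fin1); apply: eq_integral => x _.
  rewrite patchE; case: ifPn => [/set_mem D1x|/negP nD1x]; last first.
    rewrite integral0_eq// => y _.
    by rewrite /F patchE memNset// => -[/= /mem_set].
  have [i _] := ae_bounded_integrable mD2 fin2 (measurable_section2 D1x) (fC D1x).
  by rewrite -FE2// /Rintegral fineK//; exact: integrable_fin_num.
apply/esym/(@Fubini _ _ _ _ _ n1 n2 (EFin \o F)).
have mEF : measurable_fun setT (EFin \o F) by exact/measurable_EFinP.
apply/(integrable12ltyP n1 n2 mEF).
have n2b x : (\int[n2]_y `|(EFin \o F) (x, y)| <= `|C|%:E * n2 setT)%E.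
  apply: integral_le_bound => //.
    by apply: (measurableT_comp mEF); exact: pair1_measurable.
  have [D1x|nD1x] := pselect (D1 x); last first.
    apply: aeW => y _; rewrite /F/= patchE memNset// => [|[/= ]//].
    by rewrite normr0 lee_fin.
  apply/(ae_restr_measure mD2 fin2); apply: filterS (fC D1x) => y h D2y _.
  by rewrite /= lee_fin /F patchE mem_set//= (le_trans (h D2y))// ler_norm.
apply: (@le_lt_trans _ _ (\int[n1]_x (`|C|%:E * n2 setT))%E).
  apply: ge0_le_integral => //.
  - by move=> x _; exact: integral_ge0.
  - apply: (measurable_fun_fubini_tonelli_F (abse \o (EFin \o F))) => //=.
    exact: measurableT_comp.
rewrite integral_cst//; apply: lte_mul_pinfty; rewrite ?mule_ge0//.
  by rewrite fin_numM// fin_num_measure.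
by rewrite ltey_eq fin_num_measure.
Qed.

End finite_domain_fubini.

(** Dominated convergence with a constant majorant. The divisors c j stay outside the integrals
    because the intended quotients are those of a Green potential by delta(x_j)^gamma. *)
Lemma bounded_convergence_Rintegral d (T : measurableType d) (R : realType)
    (mu : {measure set T -> \bar R}) (D : set T) (g_ : nat -> T -> R)
    (g psi : T -> R) (c : nat -> R) (B : R) :
  measurable D -> (mu D < +oo)%E ->
  (forall j, measurable_fun D (g_ j)) -> measurable_fun D g -> measurable_fun D psi ->
  (forall j y, D y -> `|g_ j y / c j * psi y| <= B) ->
  {ae mu, forall y, D y -> (fun j => g_ j y / c j) @ \oo --> g y} ->
  (forall j, c j != 0) ->
  (fun j => (\int[mu]_(y in D) (g_ j y * psi y)) / c j) @ \oo -->
  \int[mu]_(y in D) (g y * psi y).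
Proof.
move=> mD muD mg_ mg mpsi gB cg c0.
pose f_ j y := g_ j y / c j * psi y.
have mf_ j : measurable_fun D (EFin \o f_ j).
  by apply/measurable_EFinP; apply: measurable_funM => //; exact: measurable_funM.
have mf : measurable_fun D (EFin \o (fun y => g y * psi y)).
  by apply/measurable_EFinP; exact: measurable_funM.
have int_ j : mu.-integrable D (EFin \o f_ j).
  apply: (@ae_bounded_integrable _ _ _ _ _ _ B mD muD _ _).1.
    exact/measurable_EFinP.
  by apply: aeW => y; exact: gB.
have -> : (fun j => (\int[mu]_(y in D) (g_ j y * psi y)) / c j) =
    (fun j => \int[mu]_(y in D) f_ j y).
  apply/funext => j; rewrite -[RHS](mulfK (c0 j)); congr (_ / _); rewrite -RintegralZr//.
  by apply: eq_Rintegral => y _; rewrite /f_ mulrAC divfK.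
have intB : mu.-integrable D (EFin \o cst B).
  apply: (@ae_bounded_integrable _ _ _ _ _ _ `|B| mD muD _ _).1 => //.
  by apply: aeW.
have cf : {ae mu, forall y, D y ->
    (EFin \o f_ j) y @[j --> \oo] --> (EFin \o (fun y => g y * psi y)) y}.
  apply: filterS cg => y cy Dy; apply: cvg_EFin; first exact: nearW.
  by apply: cvgM; [exact: cy|exact: cvg_cst].
have [intf _ cvf] := dominated_convergence mD mf_ mf cf intB
  (aeW _ (fun y j Dy => gB j y Dy)).
apply: fine_cvg; rewrite /Rintegral fineK; first exact: cvf.
exact: integrable_fin_num.
Qed.

Lemma measurable_fun_fst_on d1 d2 (T1 : measurableType d1) (T2 : measurableType d2)
    (R : realType) (D1 : set T1) (D2 : set T2) (f : T1 -> R) :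
  measurable D1 -> measurable_fun D1 f ->
  measurable_fun (D1 `*` D2) (fun p => f p.1).
Proof.
move=> mD1 mf; apply: (eq_measurable_fun (fun p => (f \_ D1) p.1)).
  by move=> p /set_mem[/= D1p _]; rewrite patchE mem_set.
apply: measurable_funTS.
exact: (measurableT_comp ((measurable_restrictT f mD1).1 mf) measurable_fst).
Qed.

Lemma measurable_fun_snd_on d1 d2 (T1 : measurableType d1) (T2 : measurableType d2)
    (R : realType) (D1 : set T1) (D2 : set T2) (f : T2 -> R) :
  measurable D2 -> measurable_fun D2 f ->
  measurable_fun (D1 `*` D2) (fun p => f p.2).
Proof.
move=> mD2 mf; apply: (eq_measurable_fun (fun p => (f \_ D2) p.2)).
  by move=> p /set_mem[_ /= D2p]; rewrite patchE mem_set.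
apply: measurable_funTS.
exact: (measurableT_comp ((measurable_restrictT f mD2).1 mf) measurable_snd).
Qed.

(** Fubini, once psi y is moved under the inner integral. The bound concerns the product f psi
    alone: where psi y = 0 both sides vanish, and elsewhere, for almost every y, f is bounded by C /
    |psi y| and hence integrable in x. *)
Lemma partial_Rintegral_duality d1 d2 (T1 : measurableType d1) (T2 : measurableType d2)
    (R : realType) (m1 : {measure set T1 -> \bar R}) (m2 : {measure set T2 -> \bar R})
    (D1 : set T1) (D2 : set T2) (f : T1 -> T2 -> R) (psi : T2 -> R) (C : R) :
  measurable D1 -> measurable D2 -> (m1 D1 < +oo)%E -> (m2 D2 < +oo)%E ->
  measurable_fun (D1 `*` D2) (fun p => f p.1 p.2) -> measurable_fun D2 psi ->
  (forall x, D1 x -> {ae m2, forall y, D2 y -> `|f x y * psi y| <= C}) ->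
  \int[m2]_(y in D2) ((\int[m1]_(x in D1) f x y) * psi y) =
  \int[m1]_(x in D1) (\int[m2]_(y in D2) (f x y * psi y)).
Proof.
move=> mD1 mD2 fin1 fin2 mf mpsi fC.
have mfpsi : measurable_fun (D1 `*` D2) (fun p => f p.1 p.2 * psi p.2).
  by apply: measurable_funM => //; exact: measurable_fun_snd_on.
rewrite -(bounded_Fubini mD1 mD2 fin1 fin2 mfpsi fC); congr fine.
apply: ae_eq_integral => //.
- apply/measurable_EFinP; apply: measurable_funM => //.
  exact: (measurable_partial_Rintegral mD1 mD2 fin1 mf).
- apply/measurable_EFinP.
  exact: (measurable_partial_Rintegral mD1 mD2 fin1 mfpsi).
apply: filterS (ae_bounded_section mD1 mD2 fin1 fin2 mfpsi fC) => y h D2y.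
congr EFin; have [->|psi0] := eqVneq (psi y) 0.
  rewrite mulr0 (@eq_Rintegral _ _ _ _ D1 (cst 0)) ?Rintegral_cst ?mul0r// => x _.
  by rewrite mulr0.
rewrite RintegralZr//.
apply: (@ae_bounded_integrable _ _ _ _ _ _ (C / `|psi y|) mD1 fin1 _ _).1.
  exact: (measurable_section1 mD1 mD2 mf).
apply: filterS (h D2y) => x h' D1x.
by rewrite ler_pdivlMr ?normr_gt0// -normrM h'.
Qed.

(** * Sign tests and weighted averages *)

Section test_function.
Context d (T : measurableType d) (R : realType) (mu : {measure set T -> \bar R}).
Variables (K : set T) (u v : T -> R).
Hypotheses (mK : measurable K) (iu : mu.-integrable K (EFin \o u))
  (iv : mu.-integrable K (EFin \o v)).

Definition sign_test (x : T) : R :=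
  \1_(K `&` [set x | v x < u x]) x - \1_(K `&` [set x | u x < v x]) x.

Let mu_ : measurable_fun K u.
Proof. by apply/measurable_EFinP; exact: measurable_int iu. Qed.

Let mv_ : measurable_fun K v.
Proof. by apply/measurable_EFinP; exact: measurable_int iv. Qed.

Lemma sign_test_measurable : measurable_fun setT sign_test.
Proof.
apply: measurable_funB; apply: measurable_indic.
  have m := measurable_fun_ltr mv_ mu_; exact: (m mK [set true]).
by have m := measurable_fun_ltr mu_ mv_; exact: (m mK [set true]).
Qed.

Lemma sign_test_le1 x : `|sign_test x| <= 1.
Proof.
rewrite /sign_test !indicE; do 2 case: (_ \in _) => /=;
  by rewrite ?subrr ?subr0 ?sub0r ?normrN ?normr1 ?normr0.
Qed.

Lemma sign_test_out x : ~ K x -> sign_test x = 0.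
Proof. by move=> nK; rewrite /sign_test !indicE !memNset ?subr0// => -[]. Qed.

Lemma sign_testE x : K x -> (u x - v x) * sign_test x = `|u x - v x|.
Proof.
move=> Kx; rewrite /sign_test !indicE; have [uv|vu|<-] := ltgtP (u x) (v x).
- rewrite memNset ?mem_set ?sub0r ?mulrN1 ?ltr0_norm ?subr_lt0//.
  by move=> -[_ /=]; rewrite ltNge (ltW uv).
- rewrite mem_set// memNset ?subr0 ?mulr1 ?gtr0_norm ?subr_gt0//.
  by move=> -[_ /=]; rewrite ltNge (ltW vu).
- by rewrite subrr mul0r normr0.
Qed.

Lemma sign_test_separates :
  \int[mu]_(x in K) (u x * sign_test x) = \int[mu]_(x in K) (v x * sign_test x) ->
  {ae mu, forall x, K x -> v x = u x}.
Proof.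
have ms : measurable_fun K sign_test.
  by apply: measurable_funTS; exact: sign_test_measurable.
have is_ (w : T -> R) : mu.-integrable K (EFin \o w) ->
    mu.-integrable K (EFin \o (fun x => w x * sign_test x)).
  move=> iw; apply: (le_integrable mK _ _ iw) => //.
    apply/measurable_EFinP; apply: measurable_funM => //.
    by apply/measurable_EFinP; exact: measurable_int iw.
  move=> x _ /=; rewrite lee_fin normrM ler_piMr//; exact: sign_test_le1.
move=> /eqP; rewrite -subr_eq0 -RintegralB ?is_// => /eqP h.
pose w x := u x - v x.
have mw : measurable_fun K (EFin \o w) by apply/measurable_EFinP; exact: measurable_funB.
suff /(ae_eq_integral_abs mu mK mw).1 : (\int[mu]_(x in K) `|(EFin \o w) x| = 0)%E.
  apply: filterS => x /= + Kx => /(_ Kx)[] /eqP.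
  by rewrite subr_eq0 => /eqP.
have -> : (\int[mu]_(x in K) `|(EFin \o w) x| =
    \int[mu]_(x in K) (u x * sign_test x - v x * sign_test x)%:E)%E.
  by apply: eq_integral => x /set_mem Kx; rewrite -mulrBl sign_testE.
rewrite -[RHS](congr1 EFin h) /Rintegral fineK//.
apply: integrable_fin_num => //.
exact: (integrableB mK (is_ _ iu) (is_ _ iv)).
Qed.

End test_function.

Lemma ae_le_Rintegral d (T : measurableType d) (R : realType)
    (mu : {measure set T -> \bar R}) (D : set T) (f g : T -> R) :
  measurable D -> mu.-integrable D (EFin \o f) -> mu.-integrable D (EFin \o g) ->
  {ae mu, forall x, D x -> f x <= g x} ->
  \int[mu]_(x in D) f x <= \int[mu]_(x in D) g x.
Proof.
move=> mD i_f i_g fg; rewrite -subr_ge0 -RintegralB//.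
have mf : measurable_fun D f by apply/measurable_EFinP; exact: measurable_int i_f.
have mg : measurable_fun D g by apply/measurable_EFinP; exact: measurable_int i_g.
have -> : \int[mu]_(x in D) (g x - f x) = \int[mu]_(x in D) `|g x - f x|.
  congr fine; apply: ae_eq_integral => //.
  - by apply/measurable_EFinP; exact: measurable_funB.
  - by apply/measurable_EFinP; apply: measurableT_comp => //; exact: measurable_funB.
  by apply: filterS fg => x fgx Dx; rewrite ger0_norm// subr_ge0 fgx.
exact: Rintegral_ge0.
Qed.

Section weighted_integral.
Context d (T : measurableType d) (R : realType) (mu : {measure set T -> \bar R}).
Variables (D : set T) (w : T -> R).
Hypotheses (mD : measurable D) (finD : (mu D < +oo)%E)
  (iw : mu.-integrable D (EFin \o w)).

Let mw : measurable_fun D w.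
Proof. by apply/measurable_EFinP; exact: measurable_int iw. Qed.

Lemma Rintegral_ge_indic (B : set T) (L : R) : measurable B -> B `<=` D ->
  {ae mu, forall x, D x -> 0 <= w x /\ (B x -> L <= w x)} ->
  L * fine (mu B) <= \int[mu]_(x in D) w x.
Proof.
move=> mB BD wL.
have i1 : mu.-integrable D (EFin \o (\1_B : T -> R)).
  apply: (@ae_bounded_integrable _ _ _ _ _ _ 1 mD finD _ _).1.
    exact: measurable_indic.
  by apply: aeW => x _; rewrite indicE; case: (_ \in _); rewrite ?normr1 ?normr0.
have -> : fine (mu B) = \int[mu]_(x in D) (\1_B x).
  by rewrite /Rintegral integral_indic// setIidl.
rewrite -RintegralZl//; apply: ae_le_Rintegral => //.
  by have := integrableZl mD L i1.
apply: filterS wL => x h Dx; have [w0 wL] := h Dx; rewrite indicE.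
by case: (boolP (x \in B)) => [/set_mem/wL|_]; rewrite ?mulr1 ?mulr0.
Qed.

(** With w = DG(., y) and a = h(theta), the left-hand side compares the Poisson integral with
    h(theta) times [ustar]. In the pointwise hypothesis, e w takes care of the points where h is
    close to a, and A of the others. *)
Lemma weighted_average_close (h : T -> R) (a M e A : R) :
  measurable_fun D h -> (forall x, D x -> `|h x| <= M) ->
  {ae mu, forall x, D x -> `|h x - a| * `|w x| <= e * w x + A} ->
  `|\int[mu]_(x in D) (h x * w x) - a * \int[mu]_(x in D) w x| <=
  e * \int[mu]_(x in D) w x + A * fine (mu D).
Proof.
move=> mh hM hA.
have ihw : mu.-integrable D (EFin \o (fun x => h x * w x)).
  apply: (le_integrable mD _ _ (integrableZl mD M iw)).
    by apply/measurable_EFinP; exact: measurable_funM.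
  move=> x Dx /=; rewrite lee_fin !normrM ler_wpM2r//.
  by apply: le_trans (hM _ Dx) _; exact: ler_norm.
have iaw : mu.-integrable D (EFin \o (fun x => a * w x)).
  by have := integrableZl mD a iw.
have iew : mu.-integrable D (EFin \o (fun x => e * w x)).
  by have := integrableZl mD e iw.
have iA : mu.-integrable D (EFin \o cst A).
  by apply: (@ae_bounded_integrable _ _ _ _ _ _ `|A| mD finD _ _).1 => //; exact: aeW.
rewrite -(RintegralZl a mD iw) -RintegralB//.
have iB := integrableB mD ihw iaw.
apply: le_trans (le_normr_Rintegral mD iB) _.
rewrite -(RintegralZl e mD iw) -(Rintegral_cst mu mD A) -RintegralD//.
apply: ae_le_Rintegral => //.
- exact: (integrable_norm iB).
- exact: (integrableD mD iew iA).
by apply: filterS hA => x h' Dx; rewrite -mulrBl normrM; exact: h'.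
Qed.

End weighted_integral.

(** * Bounds on the normal derivative of the Green kernel *)

Lemma cvg_powR_pos (R : realType) (u : nat -> R) (l p : R) : 0 < l ->
  u @ \oo --> l -> (fun j => u j `^ p) @ \oo --> l `^ p.
Proof.
move=> l0 ul; have c : {for l, continuous (fun x : R => x `^ p)}.
  apply/differentiable_continuous/derivable1_diffP/derivable_powR.
  by rewrite in_itv/= andbT.
exact: (cvg_comp u (fun x => x `^ p) ul c).
Qed.

(** The Green profile divided by delta(x)^gamma, when the minimum is its first argument. The
    right-hand side no longer contains delta(x), so it has a limit as x reaches the boundary. *)
Lemma powR_profile (R : realType) (dx dy r a g : R) : 0 < dx -> 0 < dy -> 0 < r ->
  (r `^ a)^-1 * (dx * dy / r ^+ 2) `^ g / dx `^ g = dy `^ g / r `^ (a + 2 * g).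
Proof.
move=> dx0 dy0 r0.
rewrite -powR_invn ?(ltW r0)// powRM ?powR_ge0 ?mulr_ge0 ?(ltW dx0) ?(ltW dy0)//.
rewrite powRM ?(ltW dx0) ?(ltW dy0)// -powRrM mulNr powRN powRD; last first.
  by rewrite (gt_eqF r0) implybT.
by field; rewrite !gt_eqF// powR_gt0.
Qed.

Section green_bounds.
Context (R : realType) (n : nat) (Omega : set 'rV[R]_n.+1) (s gamma : R).
Local Notation E := 'rV[R]_n.+1.
Local Notation delta := (bdist Omega).
Local Notation bd := (boundary Omega).
Local Notation leb := (@lebesgue_Rn R n).

Definition normal_profile (x y : E) : R :=
  delta y `^ gamma / enorm (x - y) `^ (n.+1%:R - 2 * s + 2 * gamma).

Hypothesis dom : bounded_C11_domain Omega.
Hypothesis gamma01 : 0 < gamma <= 1.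

Let oOmega : open Omega. Proof. by case: dom. Qed.

Lemma boundary_not_domain z : bd z -> ~ Omega z.
Proof. by move=> [_ nz] Oz; apply: nz; move: oOmega; rewrite openE; apply. Qed.

Lemma boundary_sequence z (e : R) : bd z -> 0 < e -> exists x_ : nat -> E,
  [/\ forall j, Omega (x_ j), forall j, enorm (x_ j - z) < e & x_ @ \oo --> z].
Proof.
move=> [clz _] e0.
have ex j : exists x, Omega x /\ enorm (x - z) < Num.min e j.+1%:R^-1.
  have m0 : 0 < Num.min e j.+1%:R^-1 by rewrite lt_min e0 invr_gt0 ltr0n.
  by have [x [Ox xz]] := clz _ (nbhs_enorm_ball z m0); exists x.
have [x_ x_P] := choice ex.
exists x_; split.
- by move=> j; have [] := x_P j.
- by move=> j; have [_] := x_P j; rewrite lt_min => /andP[].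
move=> A /nbhs_enormP[r r0 rA].
have := near_infty_natSinv_lt (PosNum r0); apply: filterS => j jr; apply: rA.
have [_] := x_P j; rewrite lt_min => /andP[_ /lt_trans]; exact.
Qed.

Lemma green_kernel_le (G : E -> E -> R) (C : R) x y :
  (forall x y, Omega x -> Omega y -> x != y ->
    C^-1 * green_profile Omega s gamma x y <= G x y <=
    C * green_profile Omega s gamma x y) -> 0 < C ->
  Omega x -> Omega y -> x != y -> 0 < delta x -> 0 < delta y ->
  0 <= G x y / delta x `^ gamma <= C * normal_profile x y.
Proof.
move=> hG C0 Ox Oy xy dx0 dy0; have /andP[G1 G2] := hG _ _ Ox Oy xy.
have g0 : 0 <= gamma by case/andP: gamma01 => /ltW.
have dxg : 0 < delta x `^ gamma by rewrite powR_gt0.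
have r0 : 0 < enorm (x - y) by apply: enorm_gt0; rewrite subr_eq0.
apply/andP; split.
  rewrite divr_ge0 ?powR_ge0//; apply: le_trans G1.
  by rewrite !mulr_ge0 ?invr_ge0 ?powR_ge0// ltW.
rewrite ler_pdivrMr//; apply: le_trans G2 _; rewrite -mulrA ler_pM2l//.
rewrite /normal_profile -(powR_profile _ _ dx0 dy0 r0) divfK ?gt_eqF//.
rewrite /green_profile ler_wpM2l ?invr_ge0 ?powR_ge0// ge0_ler_powR// ?nnegrE.
- by rewrite le_min ler01 andbT divr_ge0 ?exprn_ge0 ?enorm_ge0// mulr_ge0// ltW.
- by rewrite divr_ge0 ?exprn_ge0 ?enorm_ge0// mulr_ge0// ltW.
- by rewrite ge_min lexx.
Qed.

Lemma green_kernel_ge (G : E -> E -> R) (C : R) x y :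
  (forall x y, Omega x -> Omega y -> x != y ->
    C^-1 * green_profile Omega s gamma x y <= G x y <=
    C * green_profile Omega s gamma x y) -> 0 < C ->
  Omega x -> Omega y -> x != y -> 0 < delta x -> 0 < delta y ->
  delta x * delta y <= enorm (x - y) ^+ 2 ->
  C^-1 * normal_profile x y <= G x y / delta x `^ gamma.
Proof.
move=> hG C0 Ox Oy xy dx0 dy0 dxy; have /andP[G1 _] := hG _ _ Ox Oy xy.
have dxg : 0 < delta x `^ gamma by rewrite powR_gt0.
have r0 : 0 < enorm (x - y) by apply: enorm_gt0; rewrite subr_eq0.
rewrite ler_pdivlMr//; apply: le_trans G1; rewrite -mulrA ler_pM2l ?invr_gt0//.
rewrite /normal_profile -(powR_profile _ _ dx0 dy0 r0) divfK ?gt_eqF//.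
by rewrite /green_profile (min_idPl _)// ler_pdivrMr ?exprn_gt0// mul1r.
Qed.

Lemma normal_derivative_bounds (G DG : E -> E -> R) :
  green_kernel Omega s gamma G -> is_normal_derivative Omega gamma G DG ->
  exists2 C : R, 0 < C & forall z, bd z -> {ae leb, forall y, Omega y ->
    C^-1 * normal_profile z y <= DG z y <= C * normal_profile z y}.
Proof.
move=> [_ _ [C C0 hG]] [_ hDG]; exists C => // z bz.
(* A single sequence tending to z determines the exceptional null set of y. *)
have [x_ [Ox_ _ x_z]] := boundary_sequence bz ltr01.
apply: (ae_mono (hDG z bz x_ Ox_ x_z)) => y cvgDG Oy; have {}cvgDG := cvgDG Oy.
have dy0 := bdist_gt0 dom bz Oy.
have dx0 j : 0 < delta (x_ j) by apply: (bdist_gt0 dom bz); exact: Ox_.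
have zy : z != y by apply/eqP => zy; apply: (boundary_not_domain bz); rewrite zy.
have r0 : 0 < enorm (z - y) by apply: enorm_gt0; rewrite subr_eq0.
have cr : (fun j => enorm (x_ j - y)) @ \oo --> enorm (z - y).
  have c : continuous (fun x : E => enorm (x - y)).
    apply: (@enorm_lipschitz_continuous _ _ _ 1) => u v; rewrite mul1r.
    by apply: le_trans (ler_dist_enorm _ _) _; rewrite opprB addrA subrK.
  exact: (cvg_comp x_ (fun x : E => enorm (x - y)) x_z (c z)).
have ck : (fun j => normal_profile (x_ j) y) @ \oo --> normal_profile z y.
  apply: cvgMr => //; apply: cvgV; first by rewrite gt_eqF// powR_gt0.
  exact: cvg_powR_pos.
have cC (c : R) : (fun j => c * normal_profile (x_ j) y) @ \oo --> c * normal_profile z y.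
  by apply: cvgM => //; exact: cvg_cst.
have xy : \forall j \near \oo, x_ j != y.
  have near_z : \forall j \near \oo, enorm (x_ j - z) < enorm (z - y) :=
    x_z _ (nbhs_enorm_ball z r0).
  apply: filterS near_z => j h; apply/eqP => e.
  by move: h; rewrite e enorm_distC ltxx.
apply/andP; split.
  apply: (ler_cvg_to (cC C^-1) cvgDG).
  (* As delta(x_j) tends to 0 and |x_j - y| to |z - y| > 0, eventually delta(x_j) delta(y) <= |x_j -
     y|^2, so the minimum in the Green profile is its first argument and the lower bound applies. *)
  have cd : (fun j => delta (x_ j) * delta y - enorm (x_ j - y) ^+ 2) @ \oo -->
      0 * delta y - enorm (z - y) ^+ 2.
    apply: cvgB; last by rewrite expr2; exact: cvgM.
    apply: cvgMl; apply/cvgrPdist_lt => e e0.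
    have near_z : \forall j \near \oo, enorm (x_ j - z) < e :=
      x_z _ (nbhs_enorm_ball z e0).
    apply: filterS near_z => j xe.
    rewrite sub0r normrN ger0_norm ?bdist_ge0//.
    exact: le_lt_trans (bdist_le _ bz) xe.
  have e0 : 0 < enorm (z - y) ^+ 2 by rewrite exprn_gt0.
  have /cvgrPdist_lt/(_ _ e0) neg := cd.
  apply: filterS (filterI xy neg) => j [xyj].
  rewrite mul0r sub0r distrC opprK => /(le_lt_trans (ler_norm _)).
  by rewrite gtrDr subr_lt0 => /ltW h; exact: (green_kernel_ge hG).
apply: (ler_cvg_to cvgDG (cC C)).
apply: filterS xy => j xyj.
by have /andP[] := green_kernel_le hG C0 (Ox_ j) Oy xyj (dx0 j) dy0.
Qed.

End green_bounds.

(** * The normal trace of a Green potential *)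

Section normal_trace.
Context (R : realType) (n : nat) (Omega : set 'rV[R]_n.+1) (s gamma : R).
Local Notation E := 'rV[R]_n.+1.
Local Notation delta := (bdist Omega).
Local Notation bd := (boundary Omega).
Local Notation leb := (@lebesgue_Rn R n).
Local Notation sigma := (@surface_measure R n).
Local Notation lebT := (caratheodory_type (@lebesgue_outer R n)).
Local Notation surfT := (caratheodory_type (@hausdorff_outer R n)).

Hypothesis dom : bounded_C11_domain Omega.
Hypothesis gamma01 : 0 < gamma <= 1.
Hypothesis s01 : 2 * s <= n.+1%:R.

Let oOmega : open Omega. Proof. by case: dom. Qed.

Lemma domain_measurable : measurable (Omega : set lebT).
Proof. exact: open_lebesgue_measurable. Qed.

Lemma domain_lebesgue_lty : (leb Omega < +oo)%E.
Proof. by apply: bounded_lebesgue_lty; case: dom. Qed.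

Lemma boundary_measurable : measurable (bd : set surfT).
Proof.
rewrite -[bd : set surfT]setCK; apply: measurableC; apply: open_surface_measurable.
by apply: closed_openC; exact: boundary_closed.
Qed.

Lemma boundary_sigma_lty : (sigma bd < +oo)%E.
Proof. exact: boundary_surface_lty. Qed.

Lemma compact_boundary_gap (K : set E) : compact K -> K `<=` Omega ->
  exists2 d : R, 0 < d & forall y z, K y -> bd z -> d <= enorm (z - y).
Proof.
move=> cK KO; pose P (A : set E) :=
  exists2 d : R, 0 < d & forall y z, A y -> bd z -> d <= enorm (z - y).
apply: (@compact_local_prop _ K P) => //.
- by exists 1.
- move=> A B [d d0 hA] [d' d'0 hB]; exists (Num.min d d'); first by rewrite lt_min d0.
  move=> y z [Ay|By] bz; rewrite ge_min; first by rewrite hA.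
  by rewrite hB ?orbT.
- by move=> A B AB [d d0 hB]; exists d => // y z /AB; exact: hB.
move=> x /KO Ox; have /nbhs_enormP[r r0 rO] : nbhs x Omega by exact: open_nbhs_nbhs.
exists (eball x (r / 2)); first by apply: nbhs_enorm_ball; rewrite divr_gt0.
exists (r / 2); first by rewrite divr_gt0.
move=> y z yx bz; rewrite leNgt; apply/negP => zy; apply: (boundary_not_domain dom bz).
apply: rO; apply: le_lt_trans (enorm_dist_triangle y _ _) _.
by rewrite [ltRHS]splitr ltrD.
Qed.

Lemma bdist_bounded : exists2 D : R, 0 <= D & forall y z, Omega y -> bd z -> delta y <= D.
Proof.
have [M [_ hM]] := closure_domain_bounded dom.
have {}hM x : closure Omega x -> `|x| <= `|M| + 1.
  by apply: hM; rewrite (le_lt_trans (ler_norm M))// ltrDl.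
exists (n.+1%:R * ((`|M| + 1) + (`|M| + 1))).
  by rewrite mulr_ge0// !addr_ge0.
move=> y z Oy bz; apply: le_trans (bdist_le _ bz) _.
apply: le_trans (enorm_le_norm _) _; rewrite ler_wpM2l//.
by apply: le_trans (ler_normB _ _) _; rewrite lerD// hM//; [exact: subset_closure|case: bz].
Qed.

Lemma normal_profile_ge0 (x y : E) : 0 <= normal_profile Omega s gamma x y.
Proof. by rewrite divr_ge0// powR_ge0. Qed.

Lemma normal_profile_le (x y : E) (d D : R) : 0 < d -> d <= enorm (x - y) ->
  delta y <= D -> normal_profile Omega s gamma x y <=
    D `^ gamma / d `^ (n.+1%:R - 2 * s + 2 * gamma).
Proof.
move=> d0 dxy yD; have /andP[g0 _] := gamma01.
have p0 : 0 <= n.+1%:R - 2 * s + 2 * gamma.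
  by rewrite addr_ge0 ?subr_ge0// mulr_ge0// ltW.
have D0 := le_trans (bdist_ge0 _ _) yD.
apply: ler_pM; rewrite ?powR_ge0 ?invr_ge0 ?powR_ge0//.
  by apply: ge0_ler_powR; rewrite ?nnegrE ?bdist_ge0// ltW.
have r0 : 0 < enorm (x - y) by exact: lt_le_trans dxy.
rewrite lef_pV2 ?posrE ?powR_gt0//.
by apply: ge0_ler_powR; rewrite ?nnegrE ?enorm_ge0// ltW.
Qed.

Section green_op.
Variables (G DG : E -> E -> R) (psi : E -> R).
Hypotheses (hG : green_kernel Omega s gamma G)
  (hDG : is_normal_derivative Omega gamma G DG) (hpsi : Linfty_c Omega psi).

Lemma normal_derivative_section_measurable z : bd z ->
  measurable_fun (Omega : set lebT) (DG z : lebT -> R).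
Proof.
move=> bz; case: hDG => mDG _.
exact: (measurable_section2 boundary_measurable domain_measurable mDG bz).
Qed.

(** The support K of psi keeps a distance d from the boundary. When |x_j - z| < d / 2, the points of
    K are at distance at least d / 2 from x_j, away from the singularity of G, so the quotients
    times psi are bounded by a constant B and converge almost everywhere. *)
Lemma green_op_sequence z : bd z -> exists2 d : R, 0 < d & forall x_ : nat -> E,
  (forall j, Omega (x_ j)) -> (forall j, enorm (x_ j - z) < d) -> x_ @ \oo --> z ->
  (fun j => green_op Omega G psi (x_ j) / delta (x_ j) `^ gamma) @ \oo -->
  \int[leb]_(y in Omega) (DG z y * psi y).
Proof.
move=> bz; have [mpsi [M hM] [K [cK KO psiK]]] := hpsi.
have [d d0 hd] := compact_boundary_gap cK KO.
have [D D0 hD] := bdist_bounded.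
have [mG _ [C C0 GC]] := hG.
exists (d / 2); first by rewrite divr_gt0.
move=> x_ Ox_ x_d x_z.
pose B := C * (D `^ gamma / (d / 2) `^ (n.+1%:R - 2 * s + 2 * gamma)) * `|M|.
have dx0 j : 0 < delta (x_ j) by apply: (bdist_gt0 dom bz); exact: Ox_.
have f_B j (y : lebT) : Omega y -> `|G (x_ j) y / delta (x_ j) `^ gamma * psi y| <= B.
  move=> Oy; have [Ky|nKy] := pselect (K y); last first.
    rewrite psiK// mulr0 normr0 /B !mulr_ge0 ?invr_ge0 ?powR_ge0//.
    exact: ltW.
  have dxy : d / 2 <= enorm (x_ j - y).
    have := hd _ _ Ky bz; have := enorm_dist_triangle (x_ j) z y.
    by have := x_d j; rewrite (enorm_distC (x_ j) z); lra.
  have xy : x_ j != y.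
    apply/eqP => xy; move: dxy; rewrite xy subrr enorm0.
    by rewrite leNgt divr_gt0.
  have /andP[g1 g2] := green_kernel_le gamma01 GC C0 (Ox_ j) Oy xy (dx0 j)
    (bdist_gt0 dom bz Oy).
  rewrite normrM ger0_norm// ler_pM//; last first.
    by apply: le_trans (hM _ Oy) _; exact: ler_norm.
  apply: le_trans g2 _; rewrite ler_pM2l//; apply: normal_profile_le => //.
    by rewrite divr_gt0.
  exact: hD bz.
apply: (@bounded_convergence_Rintegral _ lebT R leb Omega (fun j => G (x_ j)) (DG z) psi
  (fun j => delta (x_ j) `^ gamma) B domain_measurable domain_lebesgue_lty).
- move=> j.
  exact: (measurable_section2 domain_measurable domain_measurable mG (Ox_ j)).
- exact: normal_derivative_section_measurable.
- exact: mpsi.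
- exact: f_B.
- by case: hDG => _ /(_ z bz x_ Ox_ x_z).
- by move=> j; rewrite gt_eqF// powR_gt0.
Qed.

(** The trace is a limit along a filter, while the normal derivative is given along sequences. If
    the filter limit failed, points of Omega within 1/(j+1) of z whose quotients stay e away from
    the integral would form a sequence contradicting the sequential limit. *)
Lemma normal_trace_green_op z : bd z ->
  normal_trace Omega gamma (green_op Omega G psi) z =
  \int[leb]_(y in Omega) (DG z y * psi y).
Proof.
move=> bz; have [d d0 hd] := green_op_sequence bz.
have [clz _] := bz.
have PF : ProperFilter (within Omega (nbhs z)) by exact: within_nbhs_proper.
apply: cvg_lim; first exact: Rhausdorff.
apply/cvgrPdist_lt => e e0; apply: contrapT => ne.
have ex j : exists x, [/\ Omega x, enorm (x - z) < Num.min d j.+1%:R^-1 &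
    e <= `|\int[leb]_(y in Omega) (DG z y * psi y) -
      green_op Omega G psi x / delta x `^ gamma|].
  apply: contrapT => nex; apply: ne; apply/nbhs_enormP.
  exists (Num.min d j.+1%:R^-1); first by rewrite lt_min d0 invr_gt0 ltr0n.
  move=> x xz Ox; rewrite ltNge; apply/negP => h; apply: nex; by exists x.
have [x_ x_P] := choice ex.
have Ox j : Omega (x_ j) by have [] := x_P j.
have xd j : enorm (x_ j - z) < d by have [_] := x_P j; rewrite lt_min => /andP[].
have x_z : x_ @ \oo --> z.
  move=> A /nbhs_enormP[r r0 rA].
  have := near_infty_natSinv_lt (PosNum r0); apply: filterS => j jr; apply: rA.
  have [_ + _] := x_P j; rewrite lt_min => /andP[_ xj].
  exact: lt_trans xj jr.
have /cvgrPdist_lt/(_ _ e0)[N _ /(_ N (leqnn N))] := hd _ Ox xd x_z.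
by have [_ _] := x_P N; rewrite leNgt => /negP.
Qed.

End green_op.

End normal_trace.

(** * The Poisson integral *)

Section poisson_solution.
Context (R : realType) (n : nat) (Omega : set 'rV[R]_n.+1) (s gamma : R).
Local Notation E := 'rV[R]_n.+1.
Local Notation bd := (boundary Omega).
Local Notation leb := (@lebesgue_Rn R n).
Local Notation sigma := (@surface_measure R n).
Local Notation lebT := (caratheodory_type (@lebesgue_outer R n)).
Local Notation surfT := (caratheodory_type (@hausdorff_outer R n)).
Variables (G DG : E -> E -> R) (h : E -> R).

Hypothesis dom : bounded_C11_domain Omega.
Hypothesis gamma01 : 0 < gamma <= 1.
Hypothesis s01 : 2 * s <= n.+1%:R.
Hypothesis hG : green_kernel Omega s gamma G.
Hypothesis hDG : is_normal_derivative Omega gamma G DG.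
Hypothesis ch : {within bd, continuous h}.

Let oOmega : open Omega. Proof. by case: dom. Qed.
Let mO := domain_measurable dom.
Let finO := domain_lebesgue_lty dom.
Let mbd := @boundary_measurable R n Omega.
Let finbd := boundary_sigma_lty dom.

Definition poisson (y : E) : R := \int[sigma]_(z in bd) (h z * DG z y).

Lemma compact_lebesgue_measurable (K : set E) : compact K -> measurable (K : set lebT).
Proof.
move=> cK; rewrite -[K : set lebT]setCK; apply: measurableC.
apply: open_lebesgue_measurable; apply: closed_openC; apply: compact_closed cK.
exact: norm_hausdorff.
Qed.

Lemma boundary_data_measurable : measurable_fun (bd : set surfT) (h : surfT -> R).
Proof.
apply: (measurability _ (RGenOpens.measurableE R)) => _ [_ [a [b ->]] <-].
have oh : open (h @^-1` `]a, b[%classic : set (subspace bd)).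
  by move/continuousP: ch; apply; exact: interval_open.
have /open_subspaceP[V oV VE] := oh; rewrite setIC.
have <- : V `&` bd = h @^-1` `]a, b[%classic `&` bd by exact: VE.
by apply: measurableI => //; exact: open_surface_measurable.
Qed.

Lemma poisson_integrand_measurable :
  measurable_fun (bd `*` Omega : set (surfT * lebT)%type)
    (fun p : surfT * lebT => h p.1 * DG p.1 p.2).
Proof.
have mDG := hDG.1.
apply: (@measurable_funM _ (surfT * lebT)%type R (bd `*` Omega)
  (fun p => h p.1) (fun p => DG p.1 p.2) _ mDG).
exact: (@measurable_fun_fst_on _ _ surfT lebT R bd Omega h mbd boundary_data_measurable).
Qed.

Lemma normal_derivative_compact_bound (K : set E) : compact K -> K `<=` Omega ->
  exists2 C : R, 0 <= C & forall z, bd z ->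
    {ae leb, forall y, Omega y -> K y -> `|DG z y| <= C}.
Proof.
move=> cK KO; have [d d0 hd] := compact_boundary_gap dom cK KO.
have [D D0 hD] := bdist_bounded dom.
have [C C0 hC] := normal_derivative_bounds dom gamma01 hG hDG.
exists (C * (D `^ gamma / d `^ (n.+1%:R - 2 * s + 2 * gamma))).
  by rewrite !mulr_ge0 ?invr_ge0 ?powR_ge0// ltW.
move=> z bz; apply: (ae_mono (hC z bz)) => y hy Oy Ky; have /andP[h1 h2] := hy Oy.
have np0 := normal_profile_ge0 Omega s gamma z y.
rewrite ger0_norm; last by apply: le_trans h1; rewrite mulr_ge0 ?invr_ge0// ltW.
apply: le_trans h2 _; rewrite ler_pM2l//.
by apply: (normal_profile_le gamma01 s01 d0); [exact: hd|exact: hD bz].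
Qed.

Lemma poisson_L1loc : L1loc Omega poisson.
Proof.
split.
  exact: (measurable_partial_Rintegral mbd mO finbd poisson_integrand_measurable).
move=> K cK KO; have mK := compact_lebesgue_measurable cK.
have finK : (leb K < +oo)%E.
  by apply: le_lt_trans finO; apply: le_measure; rewrite ?inE.
have [C C0 hC] := normal_derivative_compact_bound cK KO.
have [M M0 hM] := continuous_boundary_bounded dom ch.
have mf : measurable_fun (bd `*` K : set (surfT * lebT)%type)
    (fun p : surfT * lebT => h p.1 * DG p.1 p.2).
  apply: measurable_funS poisson_integrand_measurable; first exact: measurableX.
  by move=> p [? ?]; split => //; exact: KO.
apply: (@bounded_partial_Rintegral_integrable _ _ surfT lebT R sigma leb bd K
  mbd mK finbd finK (fun z y => h z * DG z y) mf (M * C)).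
move=> z bz; apply: (ae_mono (hC z bz)) => y hy Ky.
by rewrite normrM ler_pM// ?hM// hy//; exact: KO.
Qed.

(** Fubini turns the pairing with psi into a boundary integral of h(z) times the integral of DG(z,
    y) psi(y), and the latter is the normal trace of the Green potential of psi. *)
Lemma poisson_solution : is_solution Omega gamma G h poisson.
Proof.
split; first exact: poisson_L1loc.
move=> psi hpsi; have [mpsi [M hM] [K [cK KO psiK]]] := hpsi.
have [C C0 hC] := normal_derivative_compact_bound cK KO.
have [Mh Mh0 hMh] := continuous_boundary_bounded dom ch.
have M0 : 0 <= `|M| by [].
have DGpsi z : bd z -> {ae leb, forall y, Omega y -> `|DG z y * psi y| <= C * `|M|}.
  move=> bz; apply: (ae_mono (hC z bz)) => y hy Oy.
  have [Ky|nKy] := pselect (K y); last by rewrite psiK// mulr0 normr0 mulr_ge0.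
  by rewrite normrM ler_pM ?hy// (le_trans (hM _ Oy))// ler_norm.
have hDGpsi z : bd z -> {ae leb, forall y, Omega y ->
    `|h z * DG z y * psi y| <= Mh * (C * `|M|)}.
  move=> bz; apply: (ae_mono (DGpsi z bz)) => y hy Oy.
  by rewrite -mulrA normrM ler_pM ?hMh ?hy.
have -> := @partial_Rintegral_duality _ _ surfT lebT R sigma leb bd Omega
  (fun z y => h z * DG z y) psi _ mbd mO finbd finO poisson_integrand_measurable mpsi hDGpsi.
apply: eq_Rintegral => z /set_mem bz.
rewrite (normal_trace_green_op dom gamma01 s01 hG hDG hpsi bz).
have mDGpsi : measurable_fun (Omega : set lebT) (fun y : lebT => DG z y * psi y).
  apply: (@measurable_funM _ lebT R Omega (DG z) psi) => //.
  exact: (normal_derivative_section_measurable dom hDG bz).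
have [i _] := @ae_bounded_integrable _ lebT R leb Omega _ _ mO finO mDGpsi (DGpsi z bz).
rewrite -(RintegralZl (h z) mO i); apply: eq_Rintegral => y _; by rewrite mulrA.
Qed.

(** A compact exhaustion of Omega. Distances to single boundary points are used instead of [bdist],
    so that it covers Omega without first exhibiting a boundary point. *)
Definition interior_part (k : nat) : set E :=
  [set x | Omega x /\ forall z, bd z -> k.+1%:R^-1 <= enorm (x - z)].

Lemma interior_part_compact k : compact (interior_part k).
Proof.
apply: bounded_closed_compact.
  have [M [Mr hM]] := closure_domain_bounded dom.
  exists M; split => // M' MM' x [Ox _]; apply: (hM M' MM'); exact: subset_closure.
move=> x clx.
have clO : closure Omega x by apply: closure_subset clx => y [].
have xz z : bd z -> k.+1%:R^-1 <= enorm (x - z).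
  move=> bz; rewrite leNgt; apply/negP; rewrite -subr_gt0 => e0.
  have [y [[_ hy] /= yx]] := clx _ (nbhs_enorm_ball x e0).
  have := hy _ bz; rewrite leNgt => /negP; apply.
  by apply: le_lt_trans (enorm_dist_triangle x _ _) _; rewrite -ltrBrDr.
split => //; have [//|nOx] := pselect (Omega x).
have bx : bd x by split => // /interior_subset.
by have := xz _ bx; rewrite subrr enorm0 leNgt invr_gt0 ltr0n.
Qed.

Lemma interior_part_cover x : Omega x -> exists k, interior_part k x.
Proof.
move=> Ox; have /nbhs_enormP[r r0 rO] : nbhs x Omega by exact: open_nbhs_nbhs.
have [k _ /(_ k (leqnn k))/= kr] := near_infty_natSinv_lt (PosNum r0).
exists k; split => // z bz; rewrite leNgt; apply/negP => xz.
apply: (boundary_not_domain dom bz); apply: rO; rewrite enorm_distC.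
exact: lt_trans xz kr.
Qed.

Lemma solution_unique u v : is_solution Omega gamma G h u ->
  is_solution Omega gamma G h v -> {ae leb, forall x, Omega x -> v x = u x}.
Proof.
move=> [[mu iu] hu] [[mv iv] hv].
have key k : {ae leb, forall x, interior_part k x -> v x = u x}.
  have KO : interior_part k `<=` Omega by move=> x [].
  have cK := @interior_part_compact k.
  have mK := compact_lebesgue_measurable cK.
  have {}iu := iu _ cK KO; have {}iv := iv _ cK KO.
  pose psi : E -> R := @sign_test _ lebT R (interior_part k) u v.
  have hpsi : Linfty_c Omega psi.
    split.
    - by apply: measurable_funTS; exact: (@sign_test_measurable _ lebT R leb _ u v mK iu iv).
    - by exists 1 => x _; exact: sign_test_le1.
    - by exists (interior_part k); split => // x _; exact: sign_test_out.
  apply: (@sign_test_separates _ lebT R leb _ u v mK iu iv).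
  have toK (w : E -> R) : \int[leb]_(x in interior_part k) (w x * psi x) =
      \int[leb]_(x in Omega) (w x * psi x).
    rewrite [LHS]Rintegral_mkcond [RHS]Rintegral_mkcond; apply: eq_Rintegral => x _.
    rewrite !patchE; case: (boolP (x \in interior_part k)) => [/set_mem Kx|/negP nKx].
      by rewrite mem_set//; exact: KO.
    case: ifPn => // _; rewrite /psi sign_test_out ?mulr0// => Kx.
    by apply: nKx; exact/mem_set.
  by rewrite (toK u) (toK v) hu// hv.
apply: (ae_mono (ae_foralln key)) => x hx Ox.
by have [k] := interior_part_cover Ox; exact: hx.
Qed.

End poisson_solution.

(** * The ratio to [ustar] near the boundary *)

Section boundary_ratio.
Context (R : realType) (n : nat) (Omega : set 'rV[R]_n.+1) (s gamma : R).
Local Notation E := 'rV[R]_n.+1.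
Local Notation delta := (bdist Omega).
Local Notation bd := (boundary Omega).
Local Notation leb := (@lebesgue_Rn R n).
Local Notation sigma := (@surface_measure R n).
Local Notation lebT := (caratheodory_type (@lebesgue_outer R n)).
Local Notation surfT := (caratheodory_type (@hausdorff_outer R n)).
Local Notation prodT := (surfT * lebT)%type.
Local Notation p := (n.+1%:R - 2 * s + 2 * gamma).
Variables (G DG : E -> E -> R) (h : E -> R).

Hypothesis dom : bounded_C11_domain Omega.
Hypothesis gamma01 : 0 < gamma <= 1.
Hypothesis s01 : 2 * s <= n.+1%:R.
Hypothesis hG : green_kernel Omega s gamma G.
Hypothesis hDG : is_normal_derivative Omega gamma G DG.
Hypothesis ch : {within bd, continuous h}.
Hypothesis sgamma : s - 1 / 2 < gamma.

Let mO := domain_measurable dom.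
Let finO := domain_lebesgue_lty dom.
Let mbd := @boundary_measurable R n Omega.
Let finbd := boundary_sigma_lty dom.

Lemma continuous_lebesgue_measurable (f : E -> R) : continuous f ->
  measurable_fun setT (f : lebT -> R).
Proof.
exact: (@continuous_coord_measurable _ lebT R n.+1 (fun x : lebT => x : E)
  (@halfspace_lebesgue_measurable R n)).
Qed.

Lemma continuous_surface_measurable (f : E -> R) : continuous f ->
  measurable_fun setT (f : surfT -> R).
Proof.
exact: (@continuous_coord_measurable _ surfT R n.+1 (fun x : surfT => x : E)
  (@halfspace_hausdorff_measurable R n)).
Qed.

Lemma coord_fun_continuous (i : 'I_n.+1) : continuous (fun x : E => x 0 i).
Proof.
by apply: (@enorm_lipschitz_continuous _ _ _ 1) => x y; rewrite mul1r enorm_dist_coord.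
Qed.

Lemma enorm_sub_measurable :
  measurable_fun setT (fun q : prodT => enorm ((q.1 : E) - (q.2 : E))).
Proof.
apply: (@continuous_coord_measurable _ prodT R n.+1 (fun q : prodT => (q.1 : E) - (q.2 : E))).
  move=> i c.
  have m : measurable_fun setT (fun q : prodT => ((q.1 : E) 0 i - (q.2 : E) 0 i <= c)).
    apply: measurable_fun_ler; last exact: measurable_cst.
    have m1 := continuous_surface_measurable (@coord_fun_continuous i).
    have m2 := continuous_lebesgue_measurable (@coord_fun_continuous i).
    apply: measurable_funB; first exact: (measurableT_comp m1 measurable_fst).
    exact: (measurableT_comp m2 measurable_snd).
  have := m measurableT [set true] Logic.I; rewrite setTI.
  congr (measurable _); apply/seteqP; split => q;
  by rewrite /halfspace/= subr_coord.
exact: enorm_continuous.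
Qed.

Lemma bdist_measurable : measurable_fun setT (delta : lebT -> R).
Proof.
apply: continuous_lebesgue_measurable.
by apply: (@enorm_lipschitz_continuous _ _ _ 1) => x y; rewrite mul1r bdist_lipschitz.
Qed.

Lemma normal_profile_measurable :
  measurable_fun setT (fun q : prodT => normal_profile Omega s gamma q.1 q.2).
Proof.
have -> : (fun q : prodT => normal_profile Omega s gamma q.1 q.2) =
    (fun q : prodT => delta q.2 `^ gamma * enorm ((q.1 : E) - (q.2 : E)) `^ (- p)).
  by apply/funext => q; rewrite powRN.
apply: measurable_funM.
  have m := measurableT_comp (measurable_powR gamma) bdist_measurable.
  exact: (measurableT_comp m measurable_snd).
exact: (measurableT_comp (measurable_powR (- p)) enorm_sub_measurable).
Qed.

Lemma normal_derivative_ae_bounds : exists2 C : R, 0 < C &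
  {ae leb, forall y : lebT, Omega y -> {ae sigma, forall z : surfT, bd z ->
    C^-1 * normal_profile Omega s gamma z y <= DG z y <=
    C * normal_profile Omega s gamma z y}}.
Proof.
have [C C0 hC] := normal_derivative_bounds dom gamma01 hG hDG.
exists C => //.
pose F : prodT -> R := (fun q => DG q.1 q.2) \_ (bd `*` Omega).
have mF : measurable_fun setT F.
  exact: (measurable_restrictT _ (measurableX mbd mO)).1 hDG.1.
have FE z y : bd z -> Omega y -> F (z, y) = DG z y.
  by move=> bz Oy; rewrite /F patchE mem_set.
pose k (q : prodT) := normal_profile Omega s gamma q.1 q.2.
have mk c : measurable_fun setT (fun q => c * k q).
  by apply: measurable_funM => //; exact: normal_profile_measurable.
(* The pairs violating the bounds. F extends DG by 0, so B is measurable in the whole product and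
   Tonelli applies to it. *)
pose B : set prodT := [set q | ~~ (C^-1 * k q <= F q <= C * k q)].
have mB : measurable B.
  have m1 : measurable_fun setT (fun q => C^-1 * k q <= F q) by exact: measurable_fun_ler.
  have m2 : measurable_fun setT (fun q => F q <= C * k q) by exact: measurable_fun_ler.
  have -> : B = ~` ((fun q => C^-1 * k q <= F q) @^-1` [set true] `&`
      (fun q => F q <= C * k q) @^-1` [set true]).
    apply/seteqP; split => q; rewrite /B/=.
      by move=> /negP nq [q1 q2]; apply: nq; rewrite q1 q2.
    by move=> nq; apply/negP => /andP[q1 q2]; apply: nq.
  apply: measurableC; apply: measurableI.
    by have := m1 measurableT [set true] Logic.I; rewrite setTI.
  by have := m2 measurableT [set true] Logic.I; rewrite setTI.
have := @ae_swap _ _ surfT lebT R sigma leb bd Omega mbd mO finbd finO B mB _.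
move=> /(_ _)/ae_mono; apply.
  move=> z bz; apply: (ae_mono (hC z bz)) => y hy Oy.
  by rewrite /B/= FE// /k/= hy.
move=> y hy Oy; apply: (ae_mono (hy Oy)) => z hz bz.
by have /negP := hz bz; rewrite negbK FE.
Qed.

Section good_point.
Variables (C : R) (y : E).
Hypotheses (C0 : 0 < C) (Oy : Omega y).
Hypothesis good : {ae sigma, forall z : surfT, bd z ->
  C^-1 * normal_profile Omega s gamma z y <= DG z y <=
  C * normal_profile Omega s gamma z y}.

Let good_ge0 : {ae sigma, forall z : surfT, bd z -> 0 <= DG z y}.
Proof.
apply: (ae_mono good) => z hz bz; have /andP[h1 _] := hz bz.
by apply: le_trans h1; rewrite mulr_ge0 ?normal_profile_ge0// invr_ge0 ltW.
Qed.

Lemma normal_derivative_integrable z0 : bd z0 ->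
  sigma.-integrable bd (EFin \o (fun z : surfT => DG z y)).
Proof.
move=> bz0; have dy0 := bdist_gt0 dom bz0 Oy.
apply: (@ae_bounded_integrable _ surfT R sigma bd (fun z => DG z y)
  (C * (delta y `^ gamma / delta y `^ p)) mbd finbd _ _).1.
  exact: (@measurable_section1 _ _ surfT lebT R bd Omega mbd mO DG hDG.1 y Oy).
apply: (ae_mono (ae_and good good_ge0)) => z [hz hz0] bz.
have /andP[_ h2] := hz bz; rewrite ger0_norm ?hz0//.
apply: le_trans h2 _; rewrite ler_pM2l//; apply: normal_profile_le => //.
by rewrite enorm_distC; exact: bdist_le.
Qed.

(** There is a boundary point z1 within 2 delta(y) of y. The boundary points z within delta(y) of z1
    satisfy |z - y| <= 3 delta(y), hence DG(z, y) >= L for almost all of them, and their area is at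
    least c delta(y)^n. The product of the two bounds is the claim, since p - n = 1 - 2 s + 2
    gamma. *)
Lemma ustar_ge (c r0 : R) z0 :
  (forall z t, bd z -> 0 < t <= r0 ->
    ((c * t ^+ n)%:E <= hausdorff_outer (bd `&` eball z t))%E) ->
  bd z0 -> delta y <= r0 ->
  C^-1 * c / 3 `^ p * (delta y `^ gamma / delta y `^ (1 - 2 * s + 2 * gamma)) <=
  ustar Omega DG y.
Proof.
move=> hc bz0 dr0; have dy0 := bdist_gt0 dom bz0 Oy.
have [z1 bz1 yz1] := bdist_near y bz0 dy0.
pose B : set surfT := bd `&` eball z1 (delta y).
have mB : measurable B.
  apply: measurableI => //; apply: open_surface_measurable.
  rewrite openE => x xz; apply/nbhs_enormP; exists (delta y - enorm (x - z1)).
    by rewrite subr_gt0.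
  move=> x' xx'; apply: le_lt_trans (enorm_dist_triangle x _ _) _.
  by rewrite -ltrBrDr.
have p0 : 0 <= p by case/andP: gamma01 => g0 _; rewrite addr_ge0 ?subr_ge0// mulr_ge0// ltW.
have d30 : 0 < 3 * delta y by rewrite mulr_gt0.
pose L := C^-1 * (delta y `^ gamma / (3 * delta y) `^ p).
have BL : {ae sigma, forall z : surfT, bd z -> 0 <= DG z y /\ (B z -> L <= DG z y)}.
  apply: (ae_mono (ae_and good good_ge0)) => z [hz hz0] bz; split; first exact: hz0.
  move=> [_ zz1]; have /andP[h1 _] := hz bz; apply: le_trans h1.
  rewrite ler_pM2l ?invr_gt0// ler_wpM2l ?powR_ge0//.
  have zy : enorm (z - y) <= 3 * delta y.
    apply: le_trans (enorm_dist_triangle z1 _ _) _.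
    by move: zz1; rewrite /eball/= (enorm_distC z1 y); lra.
  have zy0 : 0 < enorm (z - y).
    apply: enorm_gt0; rewrite subr_eq0; apply/eqP => zy0.
    by apply: (boundary_not_domain dom bz); rewrite zy0.
  rewrite lef_pV2 ?posrE ?powR_gt0//.
  by apply: ge0_ler_powR; rewrite ?nnegrE ?enorm_ge0// ltW.
have := @Rintegral_ge_indic _ surfT R sigma bd (fun z => DG z y) mbd finbd
  (normal_derivative_integrable bz0) B L mB (@subIsetl _ _ _) BL.
apply: le_trans.
have sB : c * delta y ^+ n <= fine (sigma B).
  rewrite -lee_fin fineK; first by apply: hc => //; rewrite dy0.
  rewrite ge0_fin_numE//; apply: le_lt_trans finbd.
  by apply: le_measure; rewrite ?inE//; exact: subIsetl.
apply: le_trans (ler_wpM2l _ sB); last first.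
  by rewrite /L mulr_ge0 ?invr_ge0 ?(ltW C0)// divr_ge0 ?powR_ge0.
rewrite /L powRM ?(ltW dy0)// -(powR_mulrn n (ltW dy0)).
have -> : delta y `^ p = delta y `^ n%:R * delta y `^ (1 - 2 * s + 2 * gamma).
  rewrite -powRD; last by rewrite (gt_eqF dy0) implybT.
  by congr (_ `^ _); rewrite -natr1; ring.
rewrite le_eqVlt; apply/orP; left; apply/eqP; field.
by rewrite !gt_eqF ?powR_gt0.
Qed.

(** If |z - theta| >= eta then |z - y| >= eta / 2, because y is within eta / 2 of theta; there h
    varies by at most 2 M and DG(z, y) is at most C delta(y)^gamma / (eta / 2)^p for almost every z.
    For the other z, h(z) is within e of h(theta). *)
Lemma poisson_close (M e eta : R) theta : (forall z, bd z -> `|h z| <= M) -> 0 <= M ->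
  0 < e -> 0 < eta -> bd theta -> enorm (y - theta) < eta / 2 ->
  (forall z, bd z -> enorm (z - theta) < eta -> `|h z - h theta| < e) ->
  `|poisson Omega DG h y - h theta * ustar Omega DG y| <=
  e * ustar Omega DG y +
  (M + M) * (C * (delta y `^ gamma / (eta / 2) `^ p)) * fine (sigma bd).
Proof.
move=> hM M0 e0 eta0 bth yth heta.
apply: (@weighted_average_close _ surfT R sigma bd (fun z => DG z y) mbd finbd
  (normal_derivative_integrable bth) h (h theta) M) => //.
  exact: boundary_data_measurable ch.
apply: (ae_mono (ae_and good good_ge0)) => z [hz hz0] bz.
have D0 := hz0 bz; rewrite (ger0_norm D0).
have A0 : 0 <= (M + M) * (C * (delta y `^ gamma / (eta / 2) `^ p)).
  by rewrite !mulr_ge0 ?addr_ge0 ?invr_ge0 ?powR_ge0// ltW.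
have [zth|zth] := ltP (enorm (z - theta)) eta.
  by rewrite ler_wpDr// ler_wpM2r// ltW// heta.
rewrite ler_wpDl ?mulr_ge0 ?(ltW e0)// ler_pM//.
  by apply: le_trans (ler_normB _ _) _; rewrite lerD// hM.
have /andP[_ h2] := hz bz; apply: le_trans h2 _; rewrite ler_pM2l//.
apply: normal_profile_le => //; first by rewrite divr_gt0.
by have := enorm_dist_triangle y z theta; lra.
Qed.

End good_point.

Lemma poisson_ratio_limit :
  uniform_boundary_ratio_limit Omega (poisson Omega DG h) (ustar Omega DG) h.
Proof.
move=> e e0; have e20 : 0 < e / 2 by rewrite divr_gt0.
have [C C0 hgood] := normal_derivative_ae_bounds.
have [c [r0 [c0 r00 hc]]] := boundary_surface_ge dom.
have [M M0 hM] := continuous_boundary_bounded dom ch.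
have [eta eta0 heta] := continuous_boundary_uniform dom ch e20.
pose tau : R := 1 - 2 * s + 2 * gamma.
have tau0 : 0 < tau.
  rewrite /tau (_ : _ + _ = 2 * (gamma - (s - 1 / 2))); last by field.
  by rewrite mulr_gt0// subr_gt0.
pose A := (M + M) * (C / (eta / 2) `^ p) * fine (sigma bd).
have A0 : 0 <= A.
  by rewrite /A !mulr_ge0 ?addr_ge0 ?invr_ge0 ?powR_ge0 ?(ltW C0)// fine_ge0.
pose c1 := C^-1 * c / 3 `^ p.
have c10 : 0 < c1 by rewrite /c1 !mulr_gt0 ?invr_gt0 ?powR_gt0.
(* The condition delta(y)^tau < X makes the far contribution A delta(y)^gamma smaller than e / 2
   times the lower bound c1 delta(y)^(gamma - tau) of [ustar]; A + 1 avoids a division by zero. The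
   radius r also puts y within eta / 2 of theta and makes delta(y) an admissible radius for the area
   bound. *)
pose X := e / 2 * c1 / (A + 1).
have A10 : 0 < A + 1 by rewrite ltr_wpDl.
have X0 : 0 < X by rewrite /X !mulr_gt0// invr_gt0.
pose r := Num.min (Num.min (eta / 2) r0) (X `^ tau^-1).
exists r; first by rewrite !lt_min r00 powR_gt0// divr_gt0.
apply: (ae_mono hgood) => y hy Oy theta bth; rewrite !lt_min -andbA => /and3P[yeta yr0 yX].
have good := hy Oy.
have dy0 := bdist_gt0 dom bth Oy.
have dy_le := bdist_le y bth.
have U1 := @ustar_ge C y C0 Oy good c r0 theta hc bth (le_trans dy_le (ltW yr0)).
have close := @poisson_close C y C0 Oy good M (e / 2) eta theta hM M0 e20 eta0 bth yeta
  (fun z bz => heta theta z bth bz).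
set U := ustar Omega DG y in U1 close *; rewrite -/c1 -/tau in U1.
have dg0 : 0 < delta y `^ gamma by rewrite powR_gt0.
have dt0 : 0 < delta y `^ tau by rewrite powR_gt0.
have U0 : 0 < U by exact: lt_le_trans (mulr_gt0 c10 (divr_gt0 dg0 dt0)) U1.
have dX : delta y `^ tau < X.
  rewrite -[ltRHS]powRr1 ?(ltW X0)// -(mulVf (lt0r_neq0 tau0)) powRrM.
  apply: gt0_ltr_powR; rewrite ?nnegrE ?powR_ge0 ?(ltW dy0)//.
  exact: le_lt_trans dy_le yX.
have small : A * delta y `^ gamma < e / 2 * U.
  apply: lt_le_trans (ler_wpM2l (ltW e20) U1).
  rewrite (_ : _ * (c1 * _) = e / 2 * c1 / delta y `^ tau * delta y `^ gamma); last by ring.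
  rewrite ltr_pM2r// ltr_pdivlMr//.
  move: dX; rewrite /X ltr_pdivlMr//; apply: le_lt_trans.
  by rewrite mulrC ler_wpM2l ?(ltW dt0)// lerDl.
split; first by rewrite gt_eqF.
rewrite -(ltr_pM2r U0) -[X in _ * X < _](gtr0_norm U0) -normrM mulrBl divfK ?gt_eqF//.
apply: le_lt_trans close _.
rewrite [ltRHS](_ : _ = e / 2 * U + e / 2 * U); last by field.
rewrite ltrD2l; apply: le_lt_trans small.
by rewrite /A le_eqVlt; apply/orP; left; apply/eqP; ring.
Qed.

End boundary_ratio.

Theorem theorem4p13 (R : realType) (n : nat) (Omega : set 'rV[R]_n.+1)
    (s gamma : R) (G DG : 'rV[R]_n.+1 -> 'rV[R]_n.+1 -> R)
    (h : 'rV[R]_n.+1 -> R) :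
  bounded_C11_domain Omega ->
  0 < s <= 1 -> 0 < gamma <= 1 -> 2 * s <= n.+1%:R ->
  green_kernel Omega s gamma G ->
  is_normal_derivative Omega gamma G DG ->
  {within boundary Omega, continuous h} ->
  s - 1 / 2 < gamma ->
  (exists u, is_solution Omega gamma G h u) /\
  forall u, is_solution Omega gamma G h u ->
    (forall v, is_solution Omega gamma G h v ->
      {ae (@lebesgue_Rn R n), forall x, Omega x -> v x = u x}) /\
    uniform_boundary_ratio_limit Omega u (ustar Omega DG) h.
Proof.
move=> dom /andP[s0 s1] g01 sN hG hDG ch sg.
have sol := poisson_solution dom g01 sN hG hDG ch.
split=> [|u hu]; first by exists (poisson Omega DG h).
have uniq v : is_solution Omega gamma G h v ->
    {ae (@lebesgue_Rn R n), forall x, Omega x -> v x = u x}.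
  by move=> hv; apply: (solution_unique _ hu hv); exact: dom.
split=> // e e0.
(* The limit holds for the Poisson integral and passes to u by uniqueness, outside a null set. *)
have [r r0 hr] := poisson_ratio_limit dom g01 sN hG hDG ch sg e0.
exists r => //; apply: (ae_mono (ae_and hr (uniq _ sol))) => x [rx ux] Ox.
by rewrite -(ux Ox); exact: rx.
Qed.
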